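(* Let $y:\mathbb{R}^n\to\mathbb{R}^m$ have vector relative degree $r=(r_1,\dots,r_m)$ on an open set $\mathcal{E}\supset\mathcal{S}$ for the system $\dot x=f(x)+g(x)u$, suppose that $\alpha^i_1>0$ and $\overline{y}_i>\underline{y}_i$ for all $i\in\{1,\dots,m\}$, and let $G(x)=B(x)^\top B(x)$, where $B$ is the decoupling matrix. Let $y_{\rm d}:\mathbb{R}_{\ge0}\to\mathbb{R}^m$ be smooth and let $e(x,t)=y(x)-y_{\rm d}(t)$. Let $k_{\rm d}:\mathbb{R}^n\times\mathbb{R}_{\ge0}\to\mathbb{R}^m$ be locally Lipschitz, let $V:\mathbb{R}^n\times\mathbb{R}_{\ge0}\to\mathbb{R}_{\ge0}$ be continuously differentiable, and let $\rho,\gamma,\sigma>0$ be such that for all $(x,t)\in\mathbb{R}^n\times\mathbb{R}_{\ge0}$ $$\rho\|e(x,t)\|^2\le V(x,t),$$ $$\frac{\partial V}{\partial t}(x,t)+\frac{\partial V}{\partial x}(x,t)\big[f(x)+g(x)k_{\rm d}(x,t)\big]\le-\gamma V(x,t)-\sigma\Big\|\frac{\partial V}{\partial x}(x,t)g(x)\Big\|^2.$$ Define the controller $k(x,t)=k_{\rm d}(x,t)+k_{\rm cbf}(x,t)$ for $(x,t)\in\mathcal{E}\times\mathbb{R}_{\ge0}$, where $$k_{\rm cbf}(x,t)=\sum_{i=1}^m\big(\underline{\lambda}_i(x,t)-\overline{\lambda}_i(x,t)\big)G(x)^{-1}b_i(x),$$ $$\underline{\lambda}_i(x,t)=\max\{0,-a_i(x)-\alpha_1^i(y_i(x)-\underline{y}_i)-b_i(x)^\top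 k_{\rm d}(x,t)\},$$ $$\overline{\lambda}_i(x,t)=\max\{0,a_i(x)+\alpha_1^i(y_i(x)-\overline{y}_i)+b_i(x)^\top k_{\rm d}(x,t)\},$$ $$a_i(x)=L_f^{r_i}y_i(x)+\sum_{j=1}^{r_i-1}\alpha_{j+1}^iL_f^jy_i(x).$$ If $\mathcal{S}$ is compact, $x_0\in\mathcal{S}$, and $y_{\rm d}(t)$ and all of its derivatives are bounded, then along the trajectory $x(t)$ of the closed-loop system $\dot x=f(x)+g(x)k(x,t)$ with $x(0)=x_0$, the tracking error satisfies $$\|e(x(t),t)\|\le\beta(V(x(0),0),t)+\iota\big(\|k_{\rm cbf}(x(t),t)\|_\infty\big)\quad\text{for all }t\ge0,$$ where $\beta(r,s)=\sqrt{r/\rho}\,e^{-\frac{\gamma}{2}s}$, $\iota(\mu)=\dfrac{\mu}{2\sqrt{\gamma\rho\sigma}}$, and $\|k_{\rm cbf}(x(t),t)\|_\infty=\sup_{t\ge0}\|k_{\rm cbf}(x(t),t)\|$.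
   Context: System: $\dot x=f(x)+g(x)u$ with $x\in\mathbb{R}^n$, $u\in\mathbb{R}^m$, where $f:\mathbb{R}^n\to\mathbb{R}^n$ and $g:\mathbb{R}^n\to\mathbb{R}^{n\times m}$ are smooth (continuously differentiable as many times as necessary). The output $y=(y_1,\dots,y_m):\mathbb{R}^n\to\mathbb{R}^m$ is smooth. $\|\cdot\|$ is the Euclidean norm. The supremum $\|\cdot\|_\infty$ is taken in $[0,\infty]$, and the bound is read as trivially true where its right-hand side is $+\infty$. Lie derivatives: $L_fh(x)=\frac{\partial h}{\partial x}(x)f(x)$, $L_f^0h=h$, $L_f^ih=L_f(L_f^{i-1}h)$, and $L_gh(x)=\frac{\partial h}{\partial x}(x)g(x)\in\mathbb{R}^{1\times m}$. Vector relative degree: $y$ has vector relative degree $r=(r_1,\dots,r_m)$ (positive integers) at $x$ if for all $i$, $L_gL_f^jy_i(x)=0$ for all $j\in\{0,\dots,r_i-2\}$, and the decoupling matrix $B(x)\in\mathbb{R}^{m\times m}$, whose $i$-th row is $b_i(x)^\top:=L_gL_f^{r_i-1}y_i(x)$, is invertible. It has vector relative degree $r$ on a set if this holds at each point of the set (with the same $r$). Bounds and gains: $\underline{y}_i,\overline{y}_i\in\mathbb{R}$. For each $i$, $\alpha_i=(\alpha_1^i,\dots,\alpha_{r_i}^i)\in\mathbb{R}^{r_i}$ is such that $s^{r_i}+\alpha^i_{r_i}s^{r_i-1}+\dots+\alpha^i_2s+\alpha^i_1=\prod_{j=1}^{r_i}(s-\nu^i_j)$ with all $\nu^i_j$ real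 and negative. Barrier functions: $\underline{h}_i(x)=y_i(x)-\underline{y}_i$, $\overline{h}_i(x)=\overline{y}_i-y_i(x)$. Safe set: for $h\in\{\underline{h}_i,\overline{h}_i\}$ define recursively $\psi_0=h$ and $\psi_j=L_f\psi_{j-1}-\nu^i_j\psi_{j-1}$ for $j=1,\dots,r_i-1$ (on $\mathcal{E}$, $L_f\psi_{j-1}$ equals the time derivative of $\psi_{j-1}$ along the system, for any input). Set $\underline{\mathcal{S}}_i=\bigcap_{j=0}^{r_i-1}\{x\in\mathbb{R}^n:\psi_j(x)\ge0\}$ for $h=\underline{h}_i$, and $\overline{\mathcal{S}}_i$ likewise for $h=\overline{h}_i$. Then $\mathcal{S}:=\bigcap_{i=1}^m(\underline{\mathcal{S}}_i\cap\overline{\mathcal{S}}_i)$. *)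

(* Defs.v *)
(* MathComp / MathComp-Analysis *)
From HB Require Import structures.
From mathcomp Require Import all_boot all_order all_algebra.
From mathcomp Require Import all_classical all_reals all_analysis.

Set Implicit Arguments.
Unset Strict Implicit.
Unset Printing Implicit Defensive.

Import Order.TTheory GRing.Theory Num.Theory.
Import numFieldNormedType.Exports.

Local Open Scope classical_set_scope.
Local Open Scope ring_scope.

(* Used on row and column vectors only; the library norm [`|A|] on matrices is
   the sup norm, which induces the same topology. *)
Definition enorm (R : realType) (p q : nat) (A : 'M[R]_(p, q)) : R :=
  Num.sqrt (\sum_i \sum_j A i j ^+ 2).

Section DerivativeWithin.
Context {R : realType} {W : normedModType R}.
Implicit Types (A : set R) (F : R -> W) (t : R).

(* Derivatives relative to a set of times: one-sided at the left endpoint of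
   [0, +oo[, two-sided in the interior.  The values of F outside A (junk values
   at negative times) are never used. *)
Definition diff_quotient F t : R -> W := fun s => (s - t)^-1 *: (F s - F t).

Definition derivable_within A F t := cvg (diff_quotient F t @ within A t^').

Definition derive_within A F t : W := lim (diff_quotient F t @ within A t^').

Definition smooth_within A F :=
  forall k t, A t -> derivable_within A (iter k (derive_within A) F) t.

End DerivativeWithin.

Section VectorFields.
Context {R : realType} {n : nat}.

Definition basis_vec (j : 'I_n) : 'cV[R]_n := delta_mx j 0.

Fixpoint Ck {W : normedModType R} (k : nat) (h : 'cV[R]_n -> W) : Prop :=
  continuous h /\
  if k is k'.+1 then
    forall j, (forall x, derivable h x (basis_vec j)) /\
              Ck k' (fun x => 'D_(basis_vec j) h x)
  else True.

Definition smooth {W : normedModType R} (h : 'cV[R]_n -> W) :=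
  forall k, Ck k h.

Definition grad (h : 'cV[R]_n -> R) (x : 'cV[R]_n) : 'rV[R]_n :=
  \row_j 'D_(basis_vec j) h x.

Definition Lf (f : 'cV[R]_n -> 'cV[R]_n) (h : 'cV[R]_n -> R) : 'cV[R]_n -> R :=
  fun x => (grad h x *m f x) 0 0.

Definition Lg (m : nat) (g : 'cV[R]_n -> 'M[R]_(n, m)) (h : 'cV[R]_n -> R) :
    'cV[R]_n -> 'rV[R]_m :=
  fun x => grad h x *m g x.

(* C^1 on R^n x [0, +oo[ (up to the boundary t = 0): all first partial
   derivatives exist and are jointly continuous. *)
Definition C1_nonneg_time (V : 'cV[R]_n -> R -> R) :=
  [/\ forall x t j, 0 <= t -> derivable (V^~ t) x (basis_vec j),
      forall x t, 0 <= t -> derivable_within `[0, +oo[ (V x) t,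
      {within [set p | 0 <= p.2], continuous
         (fun p : 'cV[R]_n * R => grad (V^~ p.2) p.1)} &
      {within [set p | 0 <= p.2], continuous
         (fun p : 'cV[R]_n * R => derive_within `[0, +oo[ (V p.1) p.2)}].

(* x is a solution on I of x' = F(x, t), x(0) = x0, staying in the domain E
   of the right-hand side. *)
Definition solution_on (I : set R) (E : set 'cV[R]_n)
    (F : 'cV[R]_n -> R -> 'cV[R]_n) (x0 : 'cV[R]_n) (x : R -> 'cV[R]_n) :=
  x 0 = x0 /\
  forall t, I t -> E (x t) /\ diff_quotient x t @ within I t^' --> F (x t) t.

End VectorFields.

Section ControlSystem.
Context {R : realType} {n m : nat}.
Variables (f : 'cV[R]_n -> 'cV[R]_n) (g : 'cV[R]_n -> 'M[R]_(n, m)).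
Variables (y : 'cV[R]_n -> 'cV[R]_m) (r : 'I_m -> nat).

Definition output (i : 'I_m) : 'cV[R]_n -> R := fun x => y x i 0.

Definition LfI (k : nat) (i : 'I_m) : 'cV[R]_n -> R := iter k (Lf f) (output i).

Definition decoupling (x : 'cV[R]_n) : 'M[R]_m :=
  \matrix_(i < m) Lg g (LfI (r i).-1 i) x.

Definition b_ (i : 'I_m) (x : 'cV[R]_n) : 'cV[R]_m := (row i (decoupling x))^T.

Definition vector_relative_degree_at (x : 'cV[R]_n) :=
  [/\ forall i, (0 < r i)%N,
      forall i j, (j + 2 <= r i)%N -> Lg g (LfI j i) x = 0 &
      decoupling x \in unitmx].

Definition vector_relative_degree_on (E : set 'cV[R]_n) :=
  forall x, E x -> vector_relative_degree_at x.

(* alpha i j and nu i j are meaningful for 1 <= j <= r i only. *)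
Variables (alpha nu : 'I_m -> nat -> R) (ymin ymax : 'I_m -> R).

Definition gains :=
  forall i,
    'X^(r i) + \sum_(j < r i) alpha i j.+1 *: 'X^j
      = \prod_(1 <= j < (r i).+1) ('X - (nu i j)%:P)
    /\ forall j, (1 <= j <= r i)%N -> nu i j < 0.

Definition h_low (i : 'I_m) : 'cV[R]_n -> R := fun x => output i x - ymin i.
Definition h_up (i : 'I_m) : 'cV[R]_n -> R := fun x => ymax i - output i x.

Fixpoint psi (i : 'I_m) (h : 'cV[R]_n -> R) (j : nat) : 'cV[R]_n -> R :=
  if j is j'.+1 then fun x => Lf f (psi i h j') x - nu i j * psi i h j' x
  else h.

Definition S_low (i : 'I_m) : set 'cV[R]_n :=
  \bigcap_(j in [set j | (j < r i)%N]) [set x | 0 <= psi i (h_low i) j x].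
Definition S_up (i : 'I_m) : set 'cV[R]_n :=
  \bigcap_(j in [set j | (j < r i)%N]) [set x | 0 <= psi i (h_up i) j x].

Definition safe_set : set 'cV[R]_n :=
  \bigcap_(i in [set: 'I_m]) (S_low i `&` S_up i).

Definition a_ (i : 'I_m) (x : 'cV[R]_n) : R :=
  LfI (r i) i x + \sum_(1 <= j < r i) alpha i j.+1 * LfI j i x.

Definition gramB (x : 'cV[R]_n) : 'M[R]_m := (decoupling x)^T *m decoupling x.

Variable kd : 'cV[R]_n -> R -> 'cV[R]_m.

Definition lambda_low (i : 'I_m) (x : 'cV[R]_n) (t : R) : R :=
  Num.max 0 (- a_ i x - alpha i 1%N * (output i x - ymin i)
             - ((b_ i x)^T *m kd x t) 0 0).

Definition lambda_up (i : 'I_m) (x : 'cV[R]_n) (t : R) : R :=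
  Num.max 0 (a_ i x + alpha i 1%N * (output i x - ymax i)
             + ((b_ i x)^T *m kd x t) 0 0).

Definition kcbf (x : 'cV[R]_n) (t : R) : 'cV[R]_m :=
  \sum_(i < m)
    (lambda_low i x t - lambda_up i x t) *: (invmx (gramB x) *m b_ i x).

Definition controller (x : 'cV[R]_n) (t : R) : 'cV[R]_m := kd x t + kcbf x t.

Definition closed_loop (x : 'cV[R]_n) (t : R) : 'cV[R]_n :=
  f x + g x *m controller x t.

End ControlSystem.

Definition beta_bound (R : realType) (rho gamma : R) (v s : R) : R :=
  Num.sqrt (v / rho) * expR (- (gamma / 2) * s).

(* On [0, +oo]: the argument is a supremum that may be +oo, and then so is
   the value. *)
Definition iota_gain (R : realType) (rho gamma sigma : R) (mu : \bar R) : \bar R :=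
  (mu * ((2 * Num.sqrt (gamma * rho * sigma))^-1)%:E)%E.

Definition sup_norm_nonneg (R : realType) (m : nat) (u : R -> 'cV[R]_m) :
    \bar R :=
  ereal_sup [set (enorm (u t))%:E | t in `[0, +oo[].

(* Main.v *)
(* Along x' = c F(x, t) with c >= 0, where c vanishes outside E, the auxiliary
   functions satisfy psi_j' = c (psi_(j+1) + nu_(j+1) psi_j), and the safety
   filter makes psi_(r-1)' >= c nu_r psi_(r-1) on all of E, because alpha_1 > 0
   and ymin < ymax keep the lower and the upper correction from being active
   together. As every nu_j is negative, a psi_j that becomes negative cannot
   decrease, so S is invariant without any condition at its boundary. The same
   argument applies to chi F, where chi is a Lipschitz cutoff equal to 1 on S
   and supported near S: this field is globally Lipschitz on bounded time
   intervals, its Picard solutions stay in S, and there they solve the original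
   system. Since a solution in E never leaves S, uniqueness is uniqueness for
   chi F. Completing the square in the dissipation inequality gives
   V' <= - gamma V + mu^2 / (4 sigma) along the solution, and Gronwall's
   argument yields the tracking estimate. *)
Require Import Defs.
From HB Require Import structures.
From mathcomp Require Import all_boot all_order all_algebra.
From mathcomp Require Import all_classical all_reals all_analysis.
From mathcomp Require Import ring lra zify.
Import Order.TTheory GRing.Theory Num.Theory.
Import numFieldNormedType.Exports.
Local Open Scope classical_set_scope.
Local Open Scope ring_scope.
Set Implicit Arguments.
Unset Strict Implicit.
Unset Printing Implicit Defensive.

(** * Local Lipschitz continuity *)

(** The field is known to be Lipschitz only where the decoupling matrix is invertible, and nothing
    says in advance that a trajectory remains in [E]. Cutting the field off removes the need to
    continue local solutions, at the price of an invariance argument that tolerates a factor [c]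
    which may vanish. As [kd] is only locally Lipschitz, constants are uniform over [S] times a
    bounded interval only: the cutoff depends on a horizon [T], and the solutions for different
    horizons are joined by uniqueness. Time zero is the other obstacle: the data are meaningful for
    [0 <= t] only, so regularity is stated relative to these times, the chain rule is used at
    positive times, and continuity reaches the endpoint. Since [V] is given through continuous
    partial derivatives, its chain rule and its Lipschitz bound go through strict differentiability;
    the auxiliary functions reuse both as functions that do not depend on time. *)

Section LocalLipschitz.
Context {R : realType} {U : normedModType R} (A : set U) (p : U).

(** One constant bounds both the values and the increments, which makes the class closed under
    products. The set [A] carries the restriction to nonnegative times. *)
Definition lip_ball {W : normedModType R} (F : U -> W) (L d : R) :=
  forall q, A q -> `|q - p| < d ->
    `|F q| <= L /\
    forall q', A q' -> `|q' - p| < d -> `|F q - F q'| <= L * `|q - q'|.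

Definition lip_near {W : normedModType R} (F : U -> W) :=
  exists L d, [/\ 0 < L, 0 < d & lip_ball F L d].

Implicit Types (F G : U -> R) (L d : R).

Lemma lip_ballW {W : normedModType R} (F : U -> W) L L' d d' :
  L <= L' -> d' <= d -> lip_ball F L d -> lip_ball F L' d'.
Proof.
move=> LL dd h q Aq qd; have [h1 h2] := h q Aq (lt_le_trans qd dd).
split; first exact: le_trans h1 LL.
move=> q' Aq' qd'; apply: le_trans (h2 _ Aq' (lt_le_trans qd' dd)) _.
by rewrite ler_wpM2r.
Qed.

Lemma lip_near2 {W W' : normedModType R} (F : U -> W) (G : U -> W') :
  lip_near F -> lip_near G ->
  exists L d, [/\ 0 < L, 0 < d, lip_ball F L d & lip_ball G L d].
Proof.
move=> [L [d [L0 d0 hF]]] [L' [d' [L0' d0' hG]]].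
exists (Num.max L L'), (Num.min d d'); split.
- by rewrite lt_max L0.
- by rewrite lt_min d0.
- by apply: lip_ballW hF; rewrite ?le_max ?lexx// ge_min lexx.
- by apply: lip_ballW hG; rewrite ?le_max ?lexx ?orbT// ge_min lexx orbT.
Qed.

Lemma lip_near_cst {W : normedModType R} (c : W) : lip_near (fun=> c).
Proof.
exists (`|c| + 1), 1; split; rewrite ?ltr_wpDl// => q _ _.
split=> [|q' _ _]; first by rewrite lerDl.
by rewrite subrr normr0 mulr_ge0// addr_ge0.
Qed.

Lemma lip_near_local F G r : 0 < r ->
  (forall q, A q -> `|q - p| < r -> F q = G q) -> lip_near F -> lip_near G.
Proof.
move=> r0 FG [L [d [L0 d0 hF]]]; exists L, (Num.min d r); split => //.
  by rewrite lt_min d0.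
move=> q Aq; rewrite lt_min => /andP[qd qr]; rewrite -FG//.
have [h1 h2] := hF q Aq qd; split => // q' Aq'.
by rewrite lt_min => /andP[qd' qr']; rewrite -FG//; exact: h2.
Qed.

Lemma lip_nearD F G :
  lip_near F -> lip_near G -> lip_near (fun q => F q + G q).
Proof.
move=> hF hG; have [L [d [L0 d0 {}hF {}hG]]] := lip_near2 hF hG.
exists (L + L), d; split; rewrite ?addr_gt0// => q Aq qd.
have [f1 f2] := hF q Aq qd; have [g1 g2] := hG q Aq qd.
split=> [|q' Aq' qd']; first exact: le_trans (ler_normD _ _) (lerD f1 g1).
rewrite opprD addrACA mulrDl (le_trans (ler_normD _ _))// lerD//.
  exact: f2.
exact: g2.
Qed.

Lemma lip_nearN F : lip_near F -> lip_near (fun q => - F q).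
Proof.
move=> [L [d [L0 d0 hF]]]; exists L, d; split => // q Aq qd.
have [f1 f2] := hF q Aq qd; rewrite normrN; split=> // q' Aq' qd'.
by rewrite -opprD normrN; exact: f2.
Qed.

Lemma lip_nearB F G :
  lip_near F -> lip_near G -> lip_near (fun q => F q - G q).
Proof. by move=> hF hG; apply: lip_nearD => //; exact: lip_nearN. Qed.

Lemma lip_nearM F G :
  lip_near F -> lip_near G -> lip_near (fun q => F q * G q).
Proof.
move=> hF hG; have [L [d [L0 d0 {}hF {}hG]]] := lip_near2 hF hG.
exists (L * L + L * L), d; split; rewrite ?addr_gt0// ?mulr_gt0// => q Aq qd.
have [f1 f2] := hF q Aq qd; have [g1 g2] := hG q Aq qd.
split=> [|q' Aq' qd'].
  rewrite normrM (@le_trans _ _ (L * L))// ?ler_pM//.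
  by rewrite lerDl mulr_ge0// ltW.
have -> : F q * G q - F q' * G q' = (F q - F q') * G q + F q' * (G q - G q').
  by ring.
rewrite (le_trans (ler_normD _ _))// !normrM mulrDl lerD//.
  by rewrite mulrAC ler_pM// f2.
have [f1' _] := hF q' Aq' qd'.
by rewrite -mulrA ler_pM// g2.
Qed.

Lemma lip_near_sum (I : Type) (s : seq I) (P : pred I) (F : I -> U -> R) :
  (forall i, lip_near (F i)) -> lip_near (fun q => \sum_(i <- s | P i) F i q).
Proof.
move=> hF; elim: s => [|i s IH].
  by under eq_fun do rewrite big_nil; exact: lip_near_cst.
under eq_fun do rewrite big_cons.
by case: (P i) => //; exact: lip_nearD.
Qed.

Lemma lip_near_prod (I : Type) (s : seq I) (P : pred I) (F : I -> U -> R) :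
  (forall i, lip_near (F i)) -> lip_near (fun q => \prod_(i <- s | P i) F i q).
Proof.
move=> hF; elim: s => [|i s IH].
  by under eq_fun do rewrite big_nil; exact: lip_near_cst.
under eq_fun do rewrite big_cons.
by case: (P i) => //; exact: lip_nearM.
Qed.

Lemma lip_near_max0 F : lip_near F -> lip_near (fun q => Num.max 0 (F q)).
Proof.
move=> [L [d [L0 d0 hF]]]; exists L, d; split => // q Aq qd.
have [f1 f2] := hF q Aq qd; split.
  by rewrite ler_norml in f1; case/andP: f1 => f3 f4; rewrite ler_norml;
    case: (leP 0 (F q)) => ?; apply/andP; split => //; lra.
move=> q' Aq' qd'; apply: le_trans (f2 _ Aq' qd').
rewrite ler_norml; have := ler_norm (F q - F q').
have := lerNnormlW (lexx `|F q - F q'|).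
by case: (leP 0 (F q)) => ?; case: (leP 0 (F q')) => ? ? ?; apply/andP; split; lra.
Qed.

Lemma lip_near_neq0 F : A p -> lip_near F -> F p != 0 ->
  exists e r, [/\ 0 < e, 0 < r &
    forall q, A q -> `|q - p| < r -> e <= `|F q|].
Proof.
move=> Ap [L [d [L0 d0 hF]]] Fp.
(* Within this radius [F] moves by less than half of its absolute value at [p]. *)
exists (`|F p| / 2), (Num.min d (`|F p| / 2 / L)); split.
- by rewrite divr_gt0// normr_gt0.
- by rewrite lt_min d0 !divr_gt0// normr_gt0.
move=> q Aq; rewrite lt_min => /andP[qd qr].
have [_ f2] := hF q Aq qd.
have := f2 p Ap; rewrite subrr normr0 => /(_ d0).
rewrite ltr_pdivlMr// mulrC in qr => h.
have := ler_distD (F q) (F p) 0; rewrite !subr0 distrC => h'.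
lra.
Qed.

Lemma lip_nearV F : A p -> lip_near F -> F p != 0 -> lip_near (fun q => (F q)^-1).
Proof.
move=> Ap hF Fp; have [e [r [e0 r0 he]]] := lip_near_neq0 Ap hF Fp.
move: hF => [L [d [L0 d0 hF]]].
(* The first summand bounds the values; the second comes from 1/a - 1/b = (b - a)/(ab). *)
exists (e^-1 + e^-1 * e^-1 * L), (Num.min d r); split.
- by rewrite addr_gt0 ?mulr_gt0 ?invr_gt0.
- by rewrite lt_min d0.
move=> q Aq; rewrite lt_min => /andP[qd qr].
have Fq := he q Aq qr.
have Vq : `|F q|^-1 <= e^-1 by rewrite lef_pV2// posrE (lt_le_trans e0).
have eL : 0 <= e^-1 * e^-1 * L by rewrite ltW// !mulr_gt0 ?invr_gt0.
split=> [|q']; first by rewrite normfV (le_trans Vq)// lerDl.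
move=> Aq'; rewrite lt_min => /andP[qd' qr'].
have Fq' := he q' Aq' qr'.
have Vq' : `|F q'|^-1 <= e^-1 by rewrite lef_pV2// posrE (lt_le_trans e0).
have nz : F q != 0 by rewrite -normr_gt0 (lt_le_trans e0).
have nz' : F q' != 0 by rewrite -normr_gt0 (lt_le_trans e0).
have -> : (F q)^-1 - (F q')^-1 = (F q)^-1 * (F q')^-1 * (F q' - F q).
  by field; rewrite nz nz'.
rewrite !normrM !normfV mulrDl -[leLHS]add0r; apply: lerD.
  by rewrite mulr_ge0// invr_ge0 ltW.
rewrite -(mulrA _ L); apply: ler_pM; rewrite ?mulr_ge0 ?invr_ge0//.
  by apply: ler_pM; rewrite ?invr_ge0.
by rewrite distrC; have [_] := hF q Aq qd; exact.
Qed.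

Lemma lip_near_det k (M : U -> 'M[R]_k) :
  (forall i j, lip_near (fun q => M q i j)) -> lip_near (fun q => \det (M q)).
Proof.
move=> hM; rewrite /determinant; apply: lip_near_sum => s.
by apply: lip_nearM; [exact: lip_near_cst|exact: lip_near_prod].
Qed.

(** The cofactor formula reduces inversion to sums, products and one reciprocal. As [invmx] returns
    a singular argument unchanged, the formula is used only near [p], where the determinant stays
    away from 0. *)
Lemma lip_near_invmx k (M : U -> 'M[R]_k) : A p ->
  (forall i j, lip_near (fun q => M q i j)) -> M p \in unitmx ->
  forall i j, lip_near (fun q => invmx (M q) i j).
Proof.
move=> Ap hM; rewrite unitmxE unitfE => dp i j.
have hd := lip_near_det hM.
have [e [r [e0 r0 he]]] := lip_near_neq0 Ap hd dp.
apply: (@lip_near_local (fun q => (\det (M q))^-1 * cofactor (M q) j i) _ r) => //.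
  move=> q Aq qr; rewrite /invmx unitmxE unitfE.
  by rewrite -normr_gt0 (lt_le_trans e0 (he _ Aq qr)) !mxE.
apply: lip_nearM; first exact: lip_nearV.
apply: lip_nearM; first exact: lip_near_cst.
by apply: lip_near_det => k1 k2; under eq_fun do rewrite !mxE; exact: hM.
Qed.

Lemma norm_mx_le a b (M : 'M[R]_(a, b)) (c : R) : 0 <= c ->
  (`|M| <= c) <-> forall i j, `|M i j| <= c.
Proof.
move=> c0; rewrite [X in X <= _]/Num.Def.normr/= mx_normrE; split=> [h i j|h].
  exact: le_trans (le_bigmax _ (fun ij => `|M ij.1 ij.2|) (i, j)) h.
by apply: bigmax_le => // -[i j] _; exact: h.
Qed.

Lemma norm_mxE_le a b (M : 'M[R]_(a, b)) i j : `|M i j| <= `|M|.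
Proof. exact: (norm_mx_le M (normr_ge0 M)).1. Qed.

Lemma lip_near_mxP a b (M : U -> 'M[R]_(a, b)) :
  lip_near M <-> forall i j, lip_near (fun q => M q i j).
Proof.
split=> [[L [d [L0 d0 hM]]] i j|hM].
  exists L, d; split => // q Aq qd; have [h1 h2] := hM q Aq qd.
  split=> [|q' Aq' qd']; first exact: le_trans (norm_mxE_le _ _ _) h1.
  apply: le_trans (h2 _ Aq' qd').
  by have := norm_mxE_le (M q - M q') i j; rewrite !mxE.
suff [L [d [L0 d0 h]]] : exists L d, [/\ 0 < L, 0 < d &
    forall i, i \in enum 'I_a -> forall j, j \in enum 'I_b ->
    lip_ball (fun q => M q i j) L d].
  exists L, d; split => // q Aq qd; split=> [|q' Aq' qd'].
    apply/norm_mx_le => [|i j]; first exact: ltW.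
    by have [] := h i (mem_enum _ _) j (mem_enum _ _) q Aq qd.
  apply/norm_mx_le => [|i j]; first by rewrite mulr_ge0// ltW.
  have [_] := h i (mem_enum _ _) j (mem_enum _ _) q Aq qd.
  by rewrite !mxE; exact.
(* Common constants for finitely many members of a family that is monotone in [L] and [d]; applied
   over the rows and, within a row, over the columns. *)
have key (I : eqType) (s : seq I) (P : I -> R -> R -> Prop) :
    (forall i L L' d d', L <= L' -> d' <= d -> P i L d -> P i L' d') ->
    (forall i, exists L d, [/\ 0 < L, 0 < d & P i L d]) ->
    exists L d, [/\ 0 < L, 0 < d & forall i, i \in s -> P i L d].
  move=> mono ex; elim: s => [|i s [L [d [L0 d0 IH]]]]; first by exists 1, 1.
  have [L' [d' [L0' d0' Pi]]] := ex i.
  exists (Num.max L L'), (Num.min d d'); split.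
  - by rewrite lt_max L0.
  - by rewrite lt_min d0.
  move=> k; rewrite inE => /predU1P[->|ks].
    by apply: mono Pi; rewrite ?le_max ?lexx ?orbT// ge_min lexx orbT.
  by apply: mono (IH k ks); rewrite ?le_max ?lexx// ge_min lexx.
apply: (key) => [i L L' d d' LL dd h j jb|i].
  by apply: lip_ballW (h j jb).
by apply: key => [j L L' d d' LL dd|j]; [exact: lip_ballW|exact: hM].
Qed.

End LocalLipschitz.

(** * Strict differentiability and the chain rule *)

Section DiffQuotient.
Context {R : realType} {W : normedModType R}.
Implicit Types (F : R -> W) (I : set R) (t : R) (l : W).

Lemma cvg_within_nbhs (T : Type) (Y : topologicalType) (G : set_system T)
    (f : T -> Y) (I : set T) (l : Y) : Filter G ->
  G I -> f @ within I G --> l -> f @ G --> l.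
Proof.
move=> FG GI h P /h; rewrite /= !nbhs_simpl /within/=.
by apply: filterS2 GI => s Is; exact.
Qed.

Lemma dq_interior F I t l : nbhs t I ->
  diff_quotient F t @ within I t^' --> l -> diff_quotient F t @ t^' --> l.
Proof. by move=> tI; apply: cvg_within_nbhs; exact: nbhs_dnbhs. Qed.

Lemma dq_is_derive F t l :
  diff_quotient F t @ t^' --> l -> is_derive t 1 F l.
Proof.
move=> h; suff h' : h^-1 *: ((F \o shift t) (h *: 1) - F t) @[h --> 0^'] --> l.
  by apply: DeriveDef; [apply/cvg_ex; exists l|apply/cvg_lim].
apply/cvgrPdist_le => e e0; move/cvgrPdist_le : h => /(_ e e0)[d /= d0 hd].
exists d => //= s sd s0.
have := hd (s + t); rewrite /diff_quotient /shift /= addrK -[s *: 1]/(s * 1) mulr1.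
apply; last by rewrite -subr_eq0 addrK.
by rewrite opprD addrCA subrr addr0; rewrite /ball_/= sub0r in sd.
Qed.

Lemma is_derive_dq F t l :
  is_derive t 1 F l -> diff_quotient F t @ t^' --> l.
Proof.
move=> [hd hv].
have h' : h^-1 *: ((F \o shift t) (h *: 1) - F t) @[h --> 0^'] --> l.
  by rewrite -hv; exact: hd.
apply/cvgrPdist_le => e e0; move/cvgrPdist_le : h' => /(_ e e0)[d /= d0 h].
exists d => //= s sd st.
have := h (s - t); rewrite /diff_quotient /shift /= -[(s - t) *: 1]/((s - t) * 1).
rewrite mulr1 subrK; apply; last by rewrite subr_eq0.
by rewrite /ball_/= sub0r opprB.
Qed.

Lemma dq_continuous F I t l : diff_quotient F t @ within I t^' --> l ->
  F @ within I (nbhs t) --> F t.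
Proof.
move=> h; apply/cvgrPdist_le => e e0.
move/cvgrPdist_le : (h) => /(_ 1 ltr01)[d /= d0 hd].
have l0 : 0 < `|l| + 1 by rewrite ltr_wpDl.
exists (Num.min d (e / (`|l| + 1))) => /=.
  by rewrite lt_min d0 divr_gt0.
move=> s; rewrite /= lt_min => /andP[sd se] Is.
have [->|st] := eqVneq s t; first by rewrite subrr normr0 ltW.
have st0 : s - t != 0 by rewrite subr_eq0.
have {}hd := hd s sd st Is.
rewrite distrC -[_ - _](scalerKV st0) normrZ.
rewrite distrC ltr_pdivlMr// in se; apply: ltW; apply: le_lt_trans se.
rewrite ler_wpM2l// -/(diff_quotient F t s).
have := ler_normB l (l - diff_quotient F t s); rewrite subKr => /le_trans; apply.
by rewrite lerD2l.
Qed.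

End DiffQuotient.

Section MeanValue.
Context {R : realType}.
Implicit Types (phi dphi : R -> R) (a b l e : R).

Lemma MVT_strict_le phi dphi a b l e : a <= b ->
  (forall c, a < c < b -> is_derive c 1 phi (dphi c)) ->
  {within `[a, b], continuous phi} ->
  (forall c, a <= c <= b -> `|dphi c - l| <= e) ->
  `|phi b - phi a - l * (b - a)| <= e * `|b - a|.
Proof.
move=> ab hd hc he.
have hd' c : c \in `]a, b[ -> is_derive c 1 phi (dphi c).
  by rewrite in_itv/=; exact: hd.
have [c cab ->] := MVT_segment ab hd' hc.
rewrite -mulrBl normrM ler_wpM2r// he//.
Qed.

(** The endpoints come in either order because the coordinate and time increments to which this is
    applied may have either sign. *)
Lemma MVT_strict phi dphi a b l e :
  (forall c, Num.min a b < c < Num.max a b -> is_derive c 1 phi (dphi c)) ->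
  {within `[Num.min a b, Num.max a b], continuous phi} ->
  (forall c, Num.min a b <= c <= Num.max a b -> `|dphi c - l| <= e) ->
  `|phi b - phi a - l * (b - a)| <= e * `|b - a|.
Proof.
have [ab|/ltW ba] := leP a b; first exact: MVT_strict_le.
move=> hd hc he; have := MVT_strict_le ba hd hc he.
rewrite [`|a - b|]distrC; congr (_ <= _); rewrite -normrN; congr (`|_|); ring.
Qed.

End MeanValue.

Lemma is_derive_line {R : realType} {n : nat} (h : 'cV[R]_n -> R) z v s :
  derivable h (z + s *: v) v ->
  is_derive s 1 (fun c : R => h (z + c *: v)) ('D_v h (z + s *: v)).
Proof.
move=> hd.
have E : (fun k : R => k^-1 *: (((fun c : R => h (z + c *: v)) \o shift s)
    (k *: 1) - h (z + s *: v))) =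
  (fun k : R => k^-1 *: ((h \o shift (z + s *: v)) (k *: v) - h (z + s *: v))).
  apply/funext => k /=; congr (_ *: (h _ - _)).
  by rewrite -[k *: 1]/(k * 1) mulr1 scalerDl addrCA.
by apply: DeriveDef; rewrite /derivable /derive ?E.
Qed.

Section C1.
Context {R : realType} {n : nat}.
Variables (V : 'cV[R]_n -> R -> R).
Hypothesis VC1 : C1_nonneg_time V.
Implicit Types (x z : 'cV[R]_n) (t s : R).

Local Notation dt x t := (derive_within `[0, +oo[ (V x) t).
Local Notation dx x t := (grad (V^~ t) x).

Let VdqE x t : 0 <= t ->
  diff_quotient (V x) t @ within `[0, +oo[ t^' --> dt x t.
Proof. by case: VC1 => _ + _ _ => /(_ x t) h t0; apply: h. Qed.

Let V_is_derive x t : 0 < t -> is_derive t 1 (V x) (dt x t).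
Proof.
move=> t0; apply: dq_is_derive; apply: dq_interior (VdqE (ltW t0)).
exists t => //= s ts.
rewrite /= in_itv/= andbT; have := ler_norm (t - s); rewrite /ball_/= in ts; lra.
Qed.

Let VcontT x (a b : R) : 0 <= a -> {within `[a, b], continuous (V x)}.
Proof.
move=> a0; have sub : `[a, b] `<=` `[0 : R, +oo[.
  by move=> s /=; rewrite !in_itv/= andbT => /andP[/(le_trans a0)].
apply: (continuous_subspaceW sub).
apply/subspace_continuousP => s /=; rewrite in_itv/= andbT => s0.
exact: dq_continuous (VdqE s0).
Qed.

Let partial_near x t (e : R) : 0 <= t -> 0 < e ->
  exists d : R, 0 < d /\ forall z s, `|z - x| < d -> `|s - t| < d -> 0 <= s ->
    `|dt z s - dt x t| <= e /\ forall k, `|dx z s 0 k - dx x t 0 k| <= e.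
Proof.
move=> t0 e0; case: VC1 => _ _ /subspace_continuousP/(_ (x, t) t0) hx.
move=> /subspace_continuousP/(_ (x, t) t0) ht.
move/cvgrPdist_le : hx => /(_ e e0) /nbhs_ballP[d1 /= d10].
rewrite ball_prod_normE /= => h1.
move/cvgrPdist_le : ht => /(_ e e0) /nbhs_ballP[d2 /= d20].
rewrite ball_prod_normE /= => h2.
exists (Num.min d1 d2); split; first by rewrite lt_min d10.
move=> z s; rewrite !lt_min => /andP[z1 z2] /andP[s1 s2] s0; split.
  rewrite distrC; apply: (h2 (z, s)) => //=.
  by rewrite prod_normE/= gt_max !(distrC x, distrC t) z2.
move=> k; rewrite distrC; have := h1 (z, s); rewrite /= prod_normE/= gt_max.
rewrite !(distrC x, distrC t) z1 s1 => /(_ isT s0) h.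
apply: le_trans h; have := norm_mxE_le (dx x t - dx z s) 0 k.
by rewrite [X in `|X| <= _]mxE [(- dx z s) 0 k]mxE.
Qed.

(* Strict differentiability at (x, t): the increment is taken one coordinate at
   a time, applying the mean value theorem along each segment. *)
Lemma C1_strict x t (e : R) : 0 <= t -> 0 < e ->
  exists d : R, 0 < d /\ forall z z' s s',
    `|z - x| < d -> `|z' - x| < d -> 0 <= s -> 0 <= s' ->
    `|s - t| < d -> `|s' - t| < d ->
    `|V z s - V z' s' - ((dx x t *m (z - z')) 0 0 + dt x t * (s - s'))|
      <= e * (n%:R * `|z - z'| + `|s - s'|).
Proof.
move=> t0 e0; have [d [d0 hd]] := partial_near x t0 e0.
exists d; split => // z z' s s' zd zd' s0 s0' sd sd'.
have -> : V z s - V z' s' - ((dx x t *m (z - z')) 0 0 + dt x t * (s - s')) =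
    (V z s - V z' s - (dx x t *m (z - z')) 0 0) +
    (V z' s - V z' s' - dt x t * (s - s')) by ring.
rewrite [leRHS]mulrDr (le_trans (ler_normD _ _))// lerD//; last first.
  have mM : 0 <= Num.min s' s by rewrite le_min s0'.
  apply: (@MVT_strict _ (V z') (fun c => dt z' c)).
  - move=> c /andP[c1 _]; apply: V_is_derive; exact: le_lt_trans c1.
  - exact: VcontT.
  move=> c /andP[c1 c2]; have c0 := le_trans mM c1.
  apply: (hd z' c _ _ c0).1 => //.
  rewrite ltr_norml; rewrite !ltr_norml in sd sd'.
  case/andP: sd => ? ?; case/andP: sd' => ? ?.
  by move: c1 c2; case: (leP s' s) => ? ? ?; apply/andP; split; lra.
(* Hybrid points with the first [k] coordinates of [z] and the others of [z']: consecutive ones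
   differ in one coordinate, and the increments telescope from [z'] to [z]. *)
pose Z k := \col_i (if (i < k)%N then z i 0 else z' i 0).
have Z0 : Z 0%N = z' by apply/colP => i; rewrite mxE.
have Zn : Z n = z by apply/colP => i; rewrite mxE ltn_ord.
have -> : V z s - V z' s = \sum_(k < n) (V (Z k.+1) s - V (Z k) s).
  rewrite -(big_mkord xpredT (fun k => V (Z k.+1) s - V (Z k) s)).
  by rewrite telescope_sumr// Zn Z0.
rewrite mxE -sumrB (le_trans (ler_norm_sum _ _ _))//.
apply: (@le_trans _ _ (\sum_(k < n) e * `|z - z'|)); last first.
  by rewrite sumr_const card_ord -[X in X <= _]mulr_natr; lra.
apply: ler_sum => k _.
pose dk := z k 0 - z' k 0.
have Zk : Z k.+1 = Z k + dk *: basis_vec k.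
  apply/colP => i; rewrite !mxE /dk; have [->|ik] := eqVneq i k.
    by rewrite ltnSn ltnn eqxx mulr1 addrC subrK.
  by rewrite ltnS leq_eqVlt (inj_eq val_inj) (negbTE ik)/= mulr0 addr0.
apply: (@le_trans _ _ (e * `|dk|)); last first.
  rewrite ler_wpM2l//; first exact: ltW.
  by have := norm_mxE_le (z - z') k 0; rewrite !mxE.
have := @MVT_strict R (fun c : R => V (Z k + c *: basis_vec k) s)
  (fun c : R => dx (Z k + c *: basis_vec k) s 0 k) 0 dk (dx x t 0 k) e.
rewrite scale0r addr0 subr0 -Zk => h.
have -> : dx x t 0 k * (z - z') k 0 = dx x t 0 k * dk by rewrite !mxE.
have Vd (c : R) : is_derive c 1 (fun c : R => V (Z k + c *: basis_vec k) s)
    (dx (Z k + c *: basis_vec k) s 0 k).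
  rewrite mxE; apply: is_derive_line; case: VC1 => + _ _ _; exact.
apply: h.
  apply: continuous_subspaceT => c; apply: differentiable_continuous.
  by apply/derivable1_diffP; case: (Vd c).
move=> c /andP[c1 c2]; apply: (hd _ _ _ sd s0).2.
(* Each coordinate of a point on the segment lies between those of [z] and [z'], so in the sup norm
   the point is no farther from [x] than the farther of the two. *)
apply: (@le_lt_trans _ _ (Num.max `|z - x| `|z' - x|)); last first.
  by rewrite gt_max zd.
apply/norm_mx_le => [|i j]; first by rewrite le_max normr_ge0.
rewrite {j}(ord1 j) !mxE.
have hz : `|z i 0 - x i 0| <= `|z - x|.
  by have := norm_mxE_le (z - x) i 0; rewrite !mxE.
have hz' : `|z' i 0 - x i 0| <= `|z' - x|.
  by have := norm_mxE_le (z' - x) i 0; rewrite !mxE.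
set m := Num.max _ _.
have {}hz : `|z i 0 - x i 0| <= m by rewrite le_max hz.
have {}hz' : `|z' i 0 - x i 0| <= m by rewrite le_max hz' orbT.
have [ik|ik] := eqVneq i k; last first.
  by rewrite mulr0 addr0; case: ifP.
rewrite ik ltnn mulr1 -ik; rewrite /dk -ik in c1 c2.
rewrite ler_norml; rewrite !ler_norml in hz hz'.
case/andP: hz => ? ?; case/andP: hz' => ? ?.
by move: c1 c2; case: (leP 0) => ? ? ?; apply/andP; split; lra.
Qed.

Lemma norm_mulmx_le (w : 'rV[R]_n) (v : 'cV[R]_n) :
  `|(w *m v) 0 0| <= n%:R * `|w| * `|v|.
Proof.
rewrite mxE (le_trans (ler_norm_sum _ _ _))//.
apply: (@le_trans _ _ (\sum_(k < n) `|w| * `|v|)).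
  by apply: ler_sum => k _; rewrite normrM ler_pM// norm_mxE_le.
by rewrite sumr_const card_ord -mulr_natr; lra.
Qed.

(** Strict differentiability with tolerance 1 bounds an increment by the linear part at the centre
    plus [n + 1] times the distance; [L] collects these terms. *)
Lemma C1_lip_near x t : 0 <= t ->
  lip_near [set p : 'cV[R]_n * R | 0 <= p.2] (x, t) (fun p => V p.1 p.2).
Proof.
move=> t0; have [d [d0 hd]] := C1_strict x t0 ltr01.
pose L := n%:R * `|dx x t| + `|dt x t| + n%:R + 1.
have L0 : 0 <= L by rewrite /L !addr_ge0// mulr_ge0.
have lip z z' s s' : `|(z, s) - (x, t)| < d -> `|(z', s') - (x, t)| < d ->
    0 <= s -> 0 <= s' -> `|V z s - V z' s'| <= L * `|(z, s) - (z', s')|.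
  rewrite !prod_normE !gt_max /= => /andP[zd sd] /andP[zd' sd'] s0 s0'.
  have := hd z z' s s' zd zd' s0 s0' sd sd'.
  set v := (_ 0 0 + _); set u := V z s - _ => h.
  rewrite -[u](subrK v).
  rewrite (le_trans (ler_normD _ _))//; apply: (le_trans (lerD h (lexx _))).
  rewrite (le_trans (lerD (lexx _) (ler_normD _ _)))// normrM.
  have h2 := norm_mulmx_le (dx x t) (z - z').
  set m := Num.max _ _.
  have m1 : `|z - z'| <= m by rewrite le_max lexx.
  have m2 : `|s - s'| <= m by rewrite le_max lexx orbT.
  have h3 : n%:R * `|dx x t| * `|z - z'| <= n%:R * `|dx x t| * m.
    by rewrite ler_wpM2l// mulr_ge0.
  have h4 : `|dt x t| * `|s - s'| <= `|dt x t| * m by rewrite ler_wpM2l.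
  have h5 : n%:R * `|z - z'| <= n%:R * m by rewrite ler_wpM2l.
  rewrite /L; lra.
exists (L + `|V x t| + L * d + 1), d; split => //.
  by rewrite ltr_wpDl// !addr_ge0// mulr_ge0// ltW.
move=> [z s] /= s0 zd; split.
  have := lip z x s t zd; rewrite subrr normr0 => /(_ d0 s0 t0) h.
  have := ler_distD (V x t) (V z s) 0; rewrite !subr0 => h'.
  have h3 : L * `|(z, s) - (x, t)| <= L * d by rewrite ler_wpM2l// ltW.
  lra.
move=> [z' s'] /= s0' zd'; apply: le_trans (lip _ _ _ _ zd zd' s0 s0') _.
rewrite ler_wpM2r//; have := normr_ge0 (V x t).
have : 0 <= L * d by rewrite mulr_ge0// ltW.
lra.
Qed.

(** The strict estimate at [(x t, t)], divided by [s - t], leaves the linear part applied to the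
    difference quotient of [x]. Positivity of [t] keeps nearby times in the domain of [V], so the
    derivative is two-sided. *)
Lemma C1_chain (x : R -> 'cV[R]_n) v t : 0 < t ->
  diff_quotient x t @ t^' --> v ->
  is_derive t 1 (fun s => V (x s) s)
    (dt (x t) t + (dx (x t) t *m v) 0 0).
Proof.
move=> t0 hx; apply: dq_is_derive.
have hl : (dx (x t) t *m diff_quotient x t s) 0 0 @[s --> t^'] -->
    (dx (x t) t *m v) 0 0.
  rewrite mxE; under eq_fun do rewrite mxE.
  apply: cvg_big => [|k _]; first exact: add_continuous.
  apply: cvgM; first exact: cvg_cst.
  exact: (cvg_comp _ _ hx (@coord_continuous _ _ _ k 0 v)).
(* Bounds [n] times the norm of the quotient plus 1 once the quotient is within 1 of [v]; dividing
   the tolerance by [c] therefore leaves an error of [e / 2]. *)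
pose c := n%:R * (`|v| + 1) + 1.
have c0 : 0 < c by rewrite /c ltr_wpDl// mulr_ge0// addr_ge0.
apply/cvgrPdist_le => e e0.
have e20 : 0 < e / 2 by rewrite divr_gt0.
have [d [d0 hd]] := C1_strict (x t) (ltW t0) (divr_gt0 e20 c0).
have xt : x @ nbhs t --> x t.
  apply: (cvg_within_nbhs (I := setT)); first exact: filterT.
  by apply: (dq_continuous (l := v)); exact: cvg_within_filter.
near=> s.
have st : s != t by near: s; exact: nbhs_dnbhs_neq.
have st0 : s - t != 0 by rewrite subr_eq0.
have s0 : 0 < s by near: s; apply: nbhs_dnbhs; exact: lt_nbhsr.
have sd : `|t - s| < d.
  by near: s; apply: nbhs_dnbhs; exists d.
have xd : `|x t - x s| < d.
  by near: s; apply: nbhs_dnbhs; move/cvgrPdist_lt : xt; exact.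
have le : `|(dx (x t) t *m v) 0 0 - (dx (x t) t *m diff_quotient x t s) 0 0|
    <= e / 2 by near: s; exact: cvgr_dist_le.
have lv : `|v - diff_quotient x t s| <= 1 by near: s; exact: cvgr_dist_le.
have := hd (x s) (x t) s t; rewrite !subrr !normr0 (distrC (x s)) (distrC s).
move=> /(_ xd d0 (ltW s0) (ltW t0) sd d0).
rewrite -(distrC (x s)) -(distrC s).
set Q := diff_quotient x t s in le lv *.
have E : x s - x t = (s - t) *: Q by rewrite /Q /diff_quotient scalerA divff// scale1r.
rewrite E -scalemxAr [X in _ - (X + _)]mxE normrZ.
set q := diff_quotient _ t s.
have Eq : V (x s) s - V (x t) t = (s - t) * q.
  by rewrite /q /diff_quotient -[_ *: _]/(_ * _) mulVKf.
rewrite Eq.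
have -> a b : (s - t) * q - ((s - t) * a + b * (s - t)) = (s - t) * (q - (a + b)).
  by ring.
rewrite normrM.
have -> : n%:R * (`|s - t| * `|Q|) + `|s - t| = `|s - t| * (n%:R * `|Q| + 1) by ring.
rewrite [leRHS]mulrCA ler_pM2l ?normr_gt0//.
have hQ : `|Q| <= `|v| + 1.
  have := ler_normB v (v - Q); rewrite subKr => /le_trans; apply.
  by rewrite lerD2l.
move=> h.
have {}h : `|q - ((dx (x t) t *m Q) 0 0 + dt (x t) t)| <= e / 2.
  apply: le_trans h _; rewrite -[leRHS](@divfK _ c) ?gt_eqF//.
  apply: ler_wpM2l; first by rewrite ltW// divr_gt0.
  by rewrite /c lerD2r ler_wpM2l.
rewrite (splitr e).
have -> : dt (x t) t + (dx (x t) t *m v) 0 0 - q =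
  ((dx (x t) t *m v) 0 0 - (dx (x t) t *m Q) 0 0) -
  (q - ((dx (x t) t *m Q) 0 0 + dt (x t) t)) by ring.
by rewrite (le_trans (ler_normB _ _))// lerD.
Unshelve. all: by end_near. Qed.

End C1.

(** * Picard iteration *)

Lemma halving_le {R : realType} (c e : R) : 0 < e -> exists k, c / 2 ^+ k <= e.
Proof.
move=> e0; exists (Num.bound `|c / e|).
rewrite ler_pdivrMr ?exprn_gt0// mulrC -ler_pdivrMr//.
apply: le_trans (ler_norm _) _; apply: ltW.
apply: lt_trans (archi_boundP (normr_ge0 _)) _.
by rewrite -natrX ltr_nat ltn_expl.
Qed.

(** The intervals of radius [d k], the tail of the geometric series, around [u k] are nested; the
    supremum of their left ends lies in all of them, which gives the limit together with its
    rate. *)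
Lemma geometric_limit {R : realType} (u : nat -> R) (C : R) : 0 <= C ->
  (forall k, `|u k.+1 - u k| <= C / 2 ^+ k) ->
  exists l, forall k, `|l - u k| <= 2 * C / 2 ^+ k.
Proof.
move=> C0 hu; pose d k : R := 2 * C / 2 ^+ k.
have dS k : d k = C / 2 ^+ k + d k.+1.
  by rewrite /d exprS invfM; field; rewrite expf_neq0.
have d0 k : 0 <= d k by rewrite divr_ge0 ?exprn_ge0 ?mulr_ge0.
have lo_mono j k : (j <= k)%N -> u j - d j <= u k - d k.
  elim: k => [|k IH]; first by rewrite leqn0 => /eqP->.
  rewrite leq_eqVlt => /predU1P[->//|/IH h]; apply: le_trans h _.
  by have := hu k; rewrite ler_norml (dS k) => /andP[]; lra.
have up_mono j k : (j <= k)%N -> u k + d k <= u j + d j.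
  elim: k => [|k IH]; first by rewrite leqn0 => /eqP->.
  rewrite leq_eqVlt => /predU1P[->//|/IH]; apply: le_trans.
  by have := hu k; rewrite ler_norml (dS k) => /andP[]; lra.
have lo_up j k : u j - d j <= u k + d k.
  apply: le_trans (lo_mono j (maxn j k) (leq_maxl _ _)) _.
  apply: le_trans (up_mono k (maxn j k) (leq_maxr _ _)).
  by have := d0 (maxn j k); lra.
pose S := range (fun k => u k - d k).
exists (sup S) => k; rewrite ler_norml; apply/andP; split.
  suff : u k - d k <= sup S by rewrite /d; lra.
  apply: ub_le_sup; last by exists k.
  by exists (u 0%N + d 0%N) => _ [j _ <-].
suff : sup S <= u k + d k by rewrite /d; lra.
apply: ge_sup; first by exists (u 0%N - d 0%N), 0%N.
by move=> _ [j _ <-].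
Qed.

Lemma antiderivative {R : realType} (c : R -> R) : continuous c ->
  exists P : R -> R, P 0 = 0 /\ forall t : R, 0 <= t -> is_derive t 1 P (c t).
Proof.
(* Integration starts at -1 so that 0 is an interior point and the derivative there is two-sided. *)
move=> cc; pose F x := (\int[lebesgue_measure]_(t in `[-1, x]) c t)%R.
exists (F - cst (F 0)); split; first by rewrite !fctE subrr.
move=> t t0.
have [||||h1 h2] := @continuous_FTC1_closed R c (-1) t (t + 1).
- by rewrite ltrDl.
- apply: continuous_compact_integrable; first exact: segment_compact.
  exact: continuous_subspaceT.
- by rewrite (lt_le_trans _ t0)// oppr_lt0.
- exact: cc.
have h3 : is_derive t 1 F (c t).
  by rewrite -h2 derive1E; exact: derivableP.
have := is_deriveB h3 (is_derive_cst (F 0) t 1).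
by rewrite subr0.
Qed.

Section MeanValueInequality.
Context {R : realType}.

Lemma mean_value_le (u v du dv : R -> R) (a b : R) : a <= b ->
  (forall c, a < c < b -> is_derive c 1 u (du c)) ->
  (forall c, a < c < b -> is_derive c 1 v (dv c)) ->
  {within `[a, b], continuous u} -> {within `[a, b], continuous v} ->
  (forall c, a < c < b -> du c <= dv c) ->
  u b - u a <= v b - v a.
Proof.
rewrite le_eqVlt => /predU1P[<-|ab] hu hv cu cv hle; first by rewrite !subrr.
have hd c : c \in `]a, b[ -> is_derive c 1 (v - u) (dv c - du c).
  rewrite in_itv/= => cab; apply: is_deriveB; [exact: hv|exact: hu].
have cc : {within `[a, b], continuous (v - u)}.
  by move=> x; apply: cvgB; [exact: cv|exact: cu].
have [c cab] := MVT ab hd cc; rewrite !fctE => E.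
have : 0 <= (dv c - du c) * (b - a).
  rewrite mulr_ge0// subr_ge0 ?(ltW ab)// hle//.
rewrite -E; lra.
Qed.

Context {n : nat}.
Implicit Types (p q dp : R -> 'cV[R]_n) (v dv : R -> R).

Lemma dq_coord p (t : R) (w : 'cV[R]_n) (i : 'I_n) : diff_quotient p t @ t^' --> w ->
  is_derive t 1 (fun s => p s i 0) (w i 0).
Proof.
move=> h; apply: dq_is_derive.
have -> : diff_quotient (fun s => p s i 0) t =
    (fun M : 'cV[R]_n => M i 0) \o diff_quotient p t.
  by apply/funext => s; rewrite /diff_quotient /= !mxE.
exact: (cvg_comp _ _ h (@coord_continuous _ _ _ i 0 w)).
Qed.

Lemma coord_within p (I : set R) (i : 'I_n) : {within I, continuous p} ->
  {within I, continuous (fun s => p s i 0)}.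
Proof.
by move=> h x; exact: (cvg_comp _ _ (h x) (@coord_continuous _ _ _ i 0 (p x))).
Qed.

(** The norm is the sup norm, so the claim splits into two scalar comparisons per coordinate: the
    coordinate against [v], and its negative against [v]. *)
Lemma mean_value_vec p dp v dv (a b : R) : a <= b ->
  (forall c, a < c < b -> diff_quotient p c @ c^' --> dp c) ->
  (forall c, a < c < b -> is_derive c 1 v (dv c)) ->
  {within `[a, b], continuous p} -> {within `[a, b], continuous v} ->
  (forall c, a < c < b -> `|dp c| <= dv c) ->
  `|p b - p a| <= v b - v a.
Proof.
move=> ab hp hv cp cv hle; apply/norm_mx_le.
  (* [norm_mx_le] asks for a nonnegative bound; comparing the zero function with [v] provides it. *)
  have := @mean_value_le (cst 0) v (cst 0) dv a b ab.
  rewrite /= subrr; apply => //.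
  - by move=> x; exact: cvg_cst.
  - by move=> c /hle; exact: le_trans.
move=> i j; rewrite {j}(ord1 j) !mxE.
have hpi c : a < c < b -> is_derive c 1 (fun s => p s i 0) (dp c i 0).
  by move=> /hp; exact: dq_coord.
have ci := coord_within (i := i) cp.
have hi c : a < c < b -> `|dp c i 0| <= dv c.
  by move=> /hle; apply: le_trans; exact: norm_mxE_le.
rewrite ler_norml; apply/andP; split.
  have := @mean_value_le (- (fun s => p s i 0)) v (fun c => - dp c i 0) dv a b ab.
  move=> h; suff : - p b i 0 - - p a i 0 <= v b - v a by lra.
  apply: h => //.
  - by move=> c /hpi hc; exact: is_deriveN.
  - by move=> x; apply: cvgN; exact: ci.
  - by move=> c /hi; rewrite ler_norml => /andP[]; lra.
apply: (@mean_value_le _ v (fun c => dp c i 0) dv a b ab) => //.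
by move=> c /hi; rewrite ler_norml => /andP[].
Qed.

Lemma dq_vec p (t : R) (w : 'cV[R]_n) :
  (forall i, is_derive t 1 (fun s => p s i 0) (w i 0)) ->
  diff_quotient p t @ t^' --> w.
Proof.
move=> h; apply/cvgrPdist_le => e e0.
have : \forall s \near t^', forall i,
    `|w i 0 - diff_quotient (fun s => p s i 0) t s| <= e.
  by apply: filter_forall => i; move/cvgrPdist_le : (is_derive_dq (h i)); exact.
apply: filterS => s hs; apply/norm_mx_le => [|i j]; first exact: ltW.
by rewrite (ord1 j) !mxE; exact: hs.
Qed.

Lemma dqB p q (t : R) (wp wq : 'cV[R]_n) :
  diff_quotient p t @ t^' --> wp -> diff_quotient q t @ t^' --> wq ->
  diff_quotient (p \- q) t @ t^' --> wp - wq.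
Proof.
move=> hp hq.
have -> : diff_quotient (p \- q) t = diff_quotient p t \- diff_quotient q t.
  apply/funext => s; rewrite /diff_quotient /= -scalerBr; congr (_ *: _).
  by rewrite !opprD !opprK !addrA; congr (_ + _); rewrite addrAC.
exact: cvgB.
Qed.

Lemma is_derive_expM (A k c : R) :
  is_derive c 1 (fun t => A * expR (k * t)) (A * k * expR (k * c)).
Proof.
have h : is_derive c 1 (fun t : R => k * t) k.
  have := @is_deriveZ R _ _ id k c 1 1 (is_derive_id _ _).
  by move=> h; apply: is_derive_eq h _; rewrite -[k *: 1]/(k * 1) mulr1.
have := @is_deriveZ R _ _ _ A c 1 _ (is_derive1_comp (is_derive_expR (k * c)) h).
move=> {}h; apply: is_derive_eq h _; rewrite -[A *: _]/(A * _); ring.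
Qed.

Lemma derive_continuous_within (v dv : R -> R) (I : set R) :
  (forall c : R, is_derive c 1 v (dv c)) -> {within I, continuous v}.
Proof.
move=> h; apply: continuous_subspaceT => c; apply: differentiable_continuous.
by apply/derivable1_diffP; case: (h c).
Qed.

End MeanValueInequality.

Section Picard.
Context {R : realType} {n : nat}.
Variables (H : 'cV[R]_n * R -> 'cV[R]_n) (L M : R).
Hypothesis L1 : 1 <= L.
Hypothesis M0 : 0 <= M.
Hypothesis Hlip : forall p q, `|H p - H q| <= L * `|p - q|.
Hypothesis Hbnd : forall p, `|H p| <= M.
Implicit Types (a b p q : R -> 'cV[R]_n) (A T : R).

Lemma H_lipschitz_state x x' t : `|H (x, t) - H (x', t)| <= L * `|x - x'|.
Proof.
apply: le_trans (Hlip _ _) _; rewrite prod_normE/= subrr normr0.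
by rewrite (max_idPl _).
Qed.

(* In the norm sup_t |.| e^(-2Lt), integrating H(a(s), s) is a contraction. *)
Lemma picard_contract T p q a b A : 0 <= T -> 0 <= A -> p 0 = q 0 ->
  {within `[0, T], continuous p} -> {within `[0, T], continuous q} ->
  (forall c, 0 < c < T -> diff_quotient p c @ c^' --> H (a c, c)) ->
  (forall c, 0 < c < T -> diff_quotient q c @ c^' --> H (b c, c)) ->
  (forall c, 0 < c < T -> `|a c - b c| <= A * expR (2 * L * c)) ->
  `|p T - q T| <= A / 2 * expR (2 * L * T).
Proof.
move=> T0 A0 pq0 cp cq hp hq hab.
have := @mean_value_vec R n (p \- q) (fun c => H (a c, c) - H (b c, c))
  (fun t => A / 2 * expR (2 * L * t))
  (fun t => A / 2 * (2 * L) * expR (2 * L * t)) 0 T T0.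
rewrite /= pq0 subrr subr0 mulr0 expR0 mulr1 => h.
suff : `|p T - q T| <= A / 2 * expR (2 * L * T) - A / 2 by lra.
apply: h.
- by move=> c cT; apply: dqB; [exact: hp|exact: hq].
- by move=> c _; exact: is_derive_expM.
- by move=> x; apply: cvgB; [exact: cp|exact: cq].
- apply: derive_continuous_within => c; exact: is_derive_expM.
move=> c cT; apply: le_trans (H_lipschitz_state _ _ _) _.
(* The exponent [2 * L] is chosen so that the halved bound still has derivative [L] times the given
   distance. *)
have -> : A / 2 * (2 * L) * expR (2 * L * c) = L * (A * expR (2 * L * c)).
  by field.
by rewrite ler_wpM2l ?hab// (le_trans _ L1).
Qed.

(** Turns the linear growth [M * t] of solutions into the exponential weight from which the
    contraction starts; this is where [1 <= L] is convenient. *)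
Lemma le_expR2L t : 0 <= t -> t <= expR (2 * L * t).
Proof.
move=> t0; apply: le_trans (expR_ge1Dx _).
have : 1 * t <= L * t by rewrite ler_wpM2r.
lra.
Qed.

Lemma picard_bound T p x : 0 <= T ->
  {within `[0, T], continuous p} ->
  (forall c, 0 < c < T -> diff_quotient p c @ c^' --> H (x c, c)) ->
  forall s t, 0 <= s -> s <= t -> t <= T -> `|p t - p s| <= M * (t - s).
Proof.
move=> T0 cp hp s t s0 st tT.
have sub : `[s, t] `<=` `[0, T].
  move=> c /=; rewrite !in_itv/= => /andP[sc ct].
  by rewrite (le_trans s0 sc) (le_trans ct tT).
have := @mean_value_vec R n p (fun c => H (x c, c)) ( *%R M) (fun=> M) s t st.
rewrite -mulrBr; apply => //.
- move=> c /andP[sc ct]; apply: hp.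
  by rewrite (le_lt_trans s0 sc) (lt_le_trans ct tT).
- move=> c _; have := @is_deriveZ R _ _ id M c 1 1 (is_derive_id _ _).
  by move=> h; apply: is_derive_eq h _; rewrite -[M *: 1]/(M * 1) mulr1.
- exact: continuous_subspaceW sub cp.
- by apply: continuous_subspaceT => c; exact: mulrl_continuous.
Qed.

(** Both curves reproduce themselves under integration, so [picard_contract] applies with [a = p]
    and [b = q] any number of times, halving the weighted distance each time. *)
Lemma picard_unique T p q : 0 <= T -> p 0 = q 0 ->
  {within `[0, T], continuous p} -> {within `[0, T], continuous q} ->
  (forall c, 0 < c < T -> diff_quotient p c @ c^' --> H (p c, c)) ->
  (forall c, 0 < c < T -> diff_quotient q c @ c^' --> H (q c, c)) ->
  p T = q T.
Proof.
move=> T0 pq cp cq hp hq.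
have key k t : 0 <= t <= T -> `|p t - q t| <= (2 * M) / 2 ^+ k * expR (2 * L * t).
  elim: k t => [|k IH] t /andP[t0 tT].
    have h1 := picard_bound T0 cp hp (lexx 0) t0 tT.
    have h2 := picard_bound T0 cq hq (lexx 0) t0 tT.
    have -> : p t - q t = (p t - p 0) - (q t - q 0).
      by rewrite pq opprB addrA subrK.
    rewrite expr0 divr1 (le_trans (ler_normB _ _))//.
    have : M * t <= M * expR (2 * L * t) by rewrite ler_wpM2l// le_expR2L.
    rewrite subr0 in h1 h2; lra.
  have sub : `[0, t] `<=` `[0, T].
    by move=> c /=; rewrite !in_itv/= => /andP[-> /le_trans->].
  rewrite exprSr invfM mulrA.
  apply: (@picard_contract t p q p q) => //.
  - by rewrite mulr_ge0 ?invr_ge0 ?exprn_ge0 ?mulr_ge0.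
  - exact: continuous_subspaceW sub cp.
  - exact: continuous_subspaceW sub cq.
  - by move=> c /andP[c0 ct]; apply: hp; rewrite c0 (lt_le_trans ct).
  - by move=> c /andP[c0 ct]; apply: hq; rewrite c0 (lt_le_trans ct).
  - by move=> c /andP[c0 ct]; apply: IH; rewrite (ltW c0) (le_trans (ltW ct)).
apply/eqP; rewrite -subr_eq0 -normr_le0; apply/ler_addgt0Pr => e e0.
rewrite add0r; have TT : 0 <= T <= T by rewrite T0 lexx.
pose c := 2 * M * expR (2 * L * T).
have c0 : 0 <= c by rewrite !mulr_ge0// expR_ge0.
have [k ck] := halving_le c e0.
by apply: le_trans ck; have := key k T TT; rewrite /c mulrAC.
Qed.

(** The class in which the iteration lives: integrated curves belong to it because the field is
    bounded by [M], and it makes the next integrand continuous. *)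
Let lip_nonneg a :=
  forall s t, 0 <= s -> 0 <= t -> `|a s - a t| <= M * `|s - t|.

Let lip_within a (I : set R) : lip_nonneg a -> (forall t, I t -> 0 <= t) ->
  {within I, continuous a}.
Proof.
move=> ha I0; apply/subspace_continuousP => t It.
apply/cvgrPdist_le => e e0; have M1 : 0 < M + 1 by rewrite ltr_wpDl.
exists (e / (M + 1)) => /=; first by rewrite divr_gt0.
move=> s /=; rewrite ltr_pdivlMr// => hs Is; apply: le_trans (ltW hs).
apply: le_trans (ha _ _ (I0 _ It) (I0 _ Is)) _.
by rewrite mulrC ler_wpM2l// lerDl.
Qed.

Let picard_op a x0 : lip_nonneg a ->
  exists b, b 0 = x0 /\
    forall t, 0 <= t -> diff_quotient b t @ t^' --> H (a t, t).
Proof.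
(* [antiderivative] asks for continuity on the whole line, while [a] is controlled at nonnegative
   times only; freezing [a] at its value at 0 changes nothing for [0 <= t]. *)
move=> ha; pose c i t := H (a (Num.max 0 t), t) i 0.
have cc i : continuous (c i).
  move=> t; apply/cvgrPdist_le => e e0.
  have K0 : 0 < L * (M + 1) by rewrite mulr_gt0 ?ltr_wpDl// (lt_le_trans _ L1).
  exists (e / (L * (M + 1))) => /=; first by rewrite divr_gt0.
  move=> s /=; rewrite ltr_pdivlMr// mulrC => hs; apply: le_trans (ltW hs).
  have h := norm_mxE_le (H (a (Num.max 0 t), t) - H (a (Num.max 0 s), s)) i 0.
  rewrite !mxE in h; apply: le_trans h _; apply: le_trans (Hlip _ _) _.
  rewrite -mulrA ler_wpM2l ?(le_trans _ L1)// prod_normE/= ge_max.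
  have m0 (r : R) : 0 <= Num.max 0 r by rewrite le_max lexx.
  rewrite (le_trans (ha _ _ (m0 t) (m0 s)))//=.
    by rewrite -[X in X <= _]mul1r ler_wpM2r// lerDr.
  apply: (@le_trans _ _ (M * `|t - s|)); last by rewrite ler_wpM2r// lerDl.
  rewrite ler_wpM2l//.
  have := ler_norm (t - s); have := ler_norm (s - t).
  rewrite -[`|s - t|]distrC.
  by case: (leP 0 t) => ?; case: (leP 0 s) => ? ? ?; rewrite ler_norml;
    apply/andP; split; lra.
have [P hP] := choice (fun i => antiderivative (cc i)).
exists (fun t => \col_i (x0 i 0 + P i t)); split.
  by apply/colP => i; rewrite mxE (hP i).1 addr0.
move=> t t0; apply: dq_vec => i.
under eq_fun do rewrite mxE.
have := is_deriveD (is_derive_cst (x0 i 0) t 1) ((hP i).2 t t0).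
by rewrite add0r /c (max_idPr t0).
Qed.

Lemma picard_exists x0 : exists x : R -> 'cV[R]_n, x 0 = x0 /\
  forall t, 0 <= t -> diff_quotient x t @ t^' --> H (x t, t).
Proof.
(* [choice] needs a total relation, so a curve outside the Lipschitz class is paired with an
   arbitrary curve, here itself. *)
have /choice[Phi hPhi] : forall a, exists b, lip_nonneg a -> b 0 = x0 /\
    forall t, 0 <= t -> diff_quotient b t @ t^' --> H (a t, t).
  move=> a; have [ha|na] := pselect (lip_nonneg a).
    by have [b hb] := picard_op x0 ha; exists b.
  by exists a.
have within0 a T : (forall t, 0 <= t -> diff_quotient (Phi a) t @ t^' --> H (a t, t)) ->
    {within `[0, T], continuous (Phi a)}.
  move=> ha; apply/subspace_continuousP => t /=; rewrite in_itv/= => /andP[t0 _].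
  by apply: (dq_continuous (l := H (a t, t))); apply: cvg_within_filter; exact: ha.
have Phi_lip a : lip_nonneg a -> lip_nonneg (Phi a).
  move=> ha s t s0 t0; have [_ hd] := hPhi a ha.
  wlog st : s t s0 t0 / s <= t => [h|].
    have [|/ltW] := leP s t; first exact: h.
    by rewrite distrC (distrC s); exact: h.
  rewrite distrC (distrC s) [X in _ * X]ger0_norm ?subr_ge0//.
  apply: (@picard_bound t (Phi a) a) => //; first exact: within0.
  by move=> c /andP[c0 _]; apply: hd; exact: ltW.
pose X k := iter k Phi (fun=> x0).
have Xlip k : lip_nonneg (X k).
  elim: k => [|k IH]; last exact: Phi_lip.
  by move=> s t _ _; rewrite subrr normr0 mulr_ge0.
have X0 k : X k 0 = x0 by case: k => // k; have [] := hPhi _ (Xlip k).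
have Xd k t : 0 <= t -> diff_quotient (X k.+1) t @ t^' --> H (X k t, t).
  by have [_] := hPhi _ (Xlip k); exact.
have within1 a T : lip_nonneg a -> {within `[0, T], continuous a}.
  by move=> ha; apply: lip_within ha _ => t /=; rewrite in_itv/= => /andP[].
have Xstep k t : 0 <= t ->
    `|X k.+1 t - X k t| <= M / 2 ^+ k * expR (2 * L * t).
  elim: k t => [|k IH] t t0.
    rewrite expr0 divr1; have := Xlip 1%N t 0 t0 (lexx 0).
    rewrite subr0 (ger0_norm t0) X0 => /le_trans; apply.
    by rewrite ler_wpM2l// le_expR2L.
  rewrite exprSr invfM mulrA.
  apply: (@picard_contract t _ _ (X k.+1) (X k)) => //.
  - by rewrite divr_ge0// exprn_ge0.
  - by rewrite !X0.
  - exact: within1 (Xlip _).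
  - exact: within1 (Xlip _).
  - by move=> c /andP[/ltW c0 _]; exact: Xd.
  - by move=> c /andP[/ltW c0 _]; exact: Xd.
  - by move=> c /andP[/ltW c0 _]; exact: IH.
have /choice[x hx] : forall t, exists l : 'cV[R]_n, 0 <= t ->
    forall k, `|l - X k t| <= 2 * M * expR (2 * L * t) / 2 ^+ k.
  move=> t; have [t0|nt] := pselect (0 <= t); last by exists 0 => /nt.
  have E0 : 0 <= M * expR (2 * L * t) by rewrite mulr_ge0// expR_ge0.
  have /choice[l hl] : forall i, exists l : R, forall k,
      `|l - X k t i 0| <= 2 * (M * expR (2 * L * t)) / 2 ^+ k.
    move=> i; apply: geometric_limit => // k.
    have := norm_mxE_le (X k.+1 t - X k t) i 0; rewrite !mxE => /le_trans; apply.
    by rewrite mulrAC; exact: Xstep.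
  exists (\col_i l i) => _ k; apply/norm_mx_le.
    by rewrite divr_ge0 ?exprn_ge0 ?mulr_ge0 ?expR_ge0.
  by move=> i j; rewrite (ord1 j) !mxE -(mulrA 2); exact: hl.
have xlip : lip_nonneg x.
  move=> s t s0 t0; apply/ler_addgt0Pr => e e0.
  have [k hk] := halving_le (2 * M * expR (2 * L * s) + 2 * M * expR (2 * L * t)) e0.
  have -> : x s - x t = (x s - X k s) + (X k s - X k t) + (X k t - x t).
    by rewrite !addrA !subrK.
  rewrite mulrDl in hk.
  apply: le_trans (ler_normD _ _) _; rewrite [`|X k t - _|]distrC.
  have := ler_normD (x s - X k s) (X k s - X k t).
  have := hx s s0 k; have := hx t t0 k; have := Xlip k s t s0 t0.
  lra.
have [z0 zd] := hPhi x xlip.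
(* At a fixed time both [Phi x] and [x] are within a multiple of 2^-k of the iterate [X k.+1]: the
   former by contraction, the latter by [hx]. *)
have zx t : 0 <= t -> Phi x t = x t.
  move=> t0; apply/eqP; rewrite -subr_eq0 -normr_le0; apply/ler_addgt0Pr => e e0.
  have [k hk] := halving_le (2 * M * expR (2 * L * t)) e0.
  have h : `|Phi x t - X k.+1 t| <= 2 * M / 2 ^+ k / 2 * expR (2 * L * t).
    apply: (@picard_contract t _ _ x (X k)) => //.
    - by rewrite divr_ge0 ?exprn_ge0 ?mulr_ge0.
    - by rewrite z0 X0.
    - exact: within0.
    - exact: within1 (Xlip _).
    - by move=> c /andP[/ltW c0 _]; exact: zd.
    - by move=> c /andP[/ltW c0 _]; exact: Xd.
    - by move=> c /andP[/ltW c0 _]; rewrite mulrAC; exact: hx.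
  have h' := hx t t0 k.+1.
  rewrite -(subrK (X k.+1 t) (Phi x t)) -addrA.
  apply: le_trans (ler_normD _ _) _; rewrite [`|X k.+1 t - _|]distrC add0r.
  apply: le_trans (lerD h h') _; apply: le_trans hk.
  by rewrite le_eqVlt; apply/orP; left; apply/eqP; rewrite exprS; field;
    rewrite expf_neq0.
(* [Phi x] is the witness rather than [x]: the values of [x] at negative times are arbitrary,
   whereas [Phi x] has a two-sided derivative at 0. *)
exists (Phi x); split => // t t0; rewrite zx//; exact: zd.
Qed.

End Picard.

(** * Smooth functions *)

Section Smooth.
Context {R : realType} {n : nat}.
Implicit Types (h : 'cV[R]_n -> R) (x : 'cV[R]_n).

Lemma CkW {W : normedModType R} k (h : 'cV[R]_n -> W) : Ck k.+1 h -> Ck k h.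
Proof.
elim: k h => [|k IH] h [hc hd]; split => // j.
by have [hj1 hj2] := hd j; split => //; exact: IH.
Qed.

Lemma Ck_cst k (c : R) : Ck k (fun _ : 'cV[R]_n => c).
Proof.
elim: k c => [|k IH] c; split => //; try exact: cst_continuous.
move=> j; split=> [x|]; first exact: derivable_cst.
under eq_fun do rewrite derive_cst; exact: IH.
Qed.

Lemma CkD k h1 h2 : Ck k h1 -> Ck k h2 -> Ck k (fun x => h1 x + h2 x).
Proof.
elim: k h1 h2 => [|k IH] h1 h2 [c1 d1] [c2 d2]; split => //.
- by move=> x; exact: (continuousD (c1 x) (c2 x)).
- by move=> x; exact: (continuousD (c1 x) (c2 x)).
move=> j; have [p1 q1] := d1 j; have [p2 q2] := d2 j.
split=> [x|]; first exact: derivableD.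
by under eq_fun do rewrite deriveD//; exact: IH.
Qed.

Lemma CkM k h1 h2 : Ck k h1 -> Ck k h2 -> Ck k (fun x => h1 x * h2 x).
Proof.
elim: k h1 h2 => [|k IH] h1 h2 H1 H2; have [c1 d1] := H1; have [c2 d2] := H2;
  split => //.
- by move=> x; exact: (continuousM (c1 x) (c2 x)).
- by move=> x; exact: (continuousM (c1 x) (c2 x)).
move=> j; have [p1 q1] := d1 j; have [p2 q2] := d2 j.
split=> [x|]; first exact: derivableM.
under eq_fun do rewrite deriveM//.
by apply: CkD; apply: IH => //; exact: CkW.
Qed.

Lemma smooth_cst (c : R) : smooth (fun _ : 'cV[R]_n => c).
Proof. by move=> k; exact: Ck_cst. Qed.

Lemma smoothD h1 h2 : smooth h1 -> smooth h2 -> smooth (fun x => h1 x + h2 x).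
Proof. by move=> H1 H2 k; exact: CkD. Qed.

Lemma smoothM h1 h2 : smooth h1 -> smooth h2 -> smooth (fun x => h1 x * h2 x).
Proof. by move=> H1 H2 k; exact: CkM. Qed.

Lemma smoothB h1 h2 : smooth h1 -> smooth h2 -> smooth (fun x => h1 x - h2 x).
Proof.
move=> H1 H2; apply: smoothD => //.
under eq_fun do rewrite -mulN1r; apply: smoothM => //; exact: smooth_cst.
Qed.

Lemma smooth_sum (I : Type) (s : seq I) (h : I -> 'cV[R]_n -> R) :
  (forall i, smooth (h i)) -> smooth (fun x => \sum_(i <- s) h i x).
Proof.
move=> hs; elim: s => [|i s IH].
  by under eq_fun do rewrite big_nil; exact: smooth_cst.
by under eq_fun do rewrite big_cons; exact: smoothD.
Qed.

Lemma smooth_derivable h x j : smooth h -> derivable h x (basis_vec j).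
Proof. by move=> /(_ 1%N)[_ /(_ j)[]]. Qed.

Lemma smooth_derive h j : smooth h -> smooth (fun x => 'D_(basis_vec j) h x).
Proof. by move=> hs k; have [_ /(_ j)[]] := hs k.+1. Qed.

Lemma smooth_coord a b (M : 'cV[R]_n -> 'M[R]_(a, b)) i j :
  smooth M -> smooth (fun x => M x i j).
Proof.
move=> hM k; elim: k M {hM}(hM k) => [|k IH] M [c d]; split => //;
  try by move=> x; exact: (cvg_comp _ _ (c x) (@coord_continuous _ _ _ i j (M x))).
move=> l; have [d1 d2] := d l; split=> [x|].
  exact: (derivable_mxP M x (basis_vec l)).1.
suff -> : (fun x => 'D_(basis_vec l) (fun x => M x i j) x) =
    (fun x => ('D_(basis_vec l) M x) i j) by exact: IH.
by apply/funext => x; rewrite derive_mx// mxE.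
Qed.

Lemma cvg_mx (T : Type) (G : set_system T) a b (M : T -> 'M[R]_(a, b)) (N : 'M[R]_(a, b)) :
  Filter G -> (forall i j, M s i j @[s --> G] --> N i j) -> M @ G --> N.
Proof.
move=> FG hM; apply/cvgrPdist_le => e e0.
have : \forall s \near G, forall ij : 'I_a * 'I_b,
    `|N ij.1 ij.2 - M s ij.1 ij.2| <= e.
  by apply: filter_forall => ij; move/cvgrPdist_le : (hM ij.1 ij.2); exact.
apply: filterS => s hs; apply/norm_mx_le => [|i j]; first exact: ltW.
by rewrite !mxE; exact: (hs (i, j)).
Qed.

Lemma derive_within_nonneg_cst (c t : R) : 0 <= t ->
  derive_within `[0, +oo[ (fun=> c) t = 0.
Proof.
move=> t0; rewrite /derive_within.
have -> : diff_quotient (fun=> c) t = (fun=> 0 : R).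
  by apply/funext => s; rewrite /diff_quotient subrr scaler0.
apply: lim_cst => //; apply: Build_ProperFilter_ex.
move=> P [d /= d0 hP]; exists (t + d / 2); apply: hP.
- rewrite /ball_/= opprD addrA subrr add0r normrN ger0_norm ?divr_ge0 ?ltW//.
  by rewrite ltr_pdivrMr// ltr_pMr// ltr1n.
- by rewrite -subr_eq0 addrAC subrr add0r gt_eqF// divr_gt0.
- by rewrite /= in_itv/= andbT addr_ge0// divr_ge0// ltW.
Qed.

(** Lets functions of the state alone inherit the chain rule and the Lipschitz bound already
    established for functions of state and time. *)
Lemma smooth_C1 h : smooth h -> C1_nonneg_time (fun x _ => h x).
Proof.
move=> hs.
have dqE x t : diff_quotient (fun=> h x) t = (fun=> 0 : R).
  by apply/funext => s; rewrite /diff_quotient subrr scaler0.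
split=> [x t j _|x t _||].
- exact: smooth_derivable.
- rewrite /derivable_within dqE; exact: is_cvg_cst.
- apply/subspace_continuousP => -[x t] _; apply: cvg_mx => i j.
  have -> : (fun q : 'cV[R]_n * R => grad h q.1 i j) =
      (fun q => 'D_(basis_vec j) h q.1) by apply/funext => q; rewrite mxE.
  rewrite [X in _ --> X]mxE; apply: cvg_within_filter.
  have [hc _] := smooth_derive j hs 0%N.
  exact: (cvg_comp _ _ (@cvg_fst _ _ (nbhs x) (nbhs t) _) (hc x)).
- apply/subspace_continuousP => p p0; apply/cvgrPdist_le => e e0.
  apply: filterS (withinT _ _) => q q0.
  by rewrite /from_subspace !derive_within_nonneg_cst// subrr normr0 ltW.
Qed.

Lemma smooth_lip_near h x t : smooth h -> 0 <= t ->
  lip_near [set p : 'cV[R]_n * R | 0 <= p.2] (x, t) (fun p => h p.1).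
Proof. by move=> hs t0; exact: (C1_lip_near (smooth_C1 hs) x t0). Qed.

Lemma smooth_chain h (x : R -> 'cV[R]_n) v t : smooth h -> 0 < t ->
  diff_quotient x t @ t^' --> v ->
  is_derive t 1 (h \o x) ((grad h (x t) *m v) 0 0).
Proof.
move=> hs t0 hx; have := C1_chain (smooth_C1 hs) t0 hx.
by rewrite derive_within_nonneg_cst ?add0r// ltW.
Qed.

Lemma grad_cst (c : R) (x : 'cV[R]_n) : grad (fun=> c) x = 0.
Proof. by apply/rowP => j; rewrite !mxE derive_cst. Qed.

Lemma grad_lin h1 h2 (c : R) x : smooth h1 -> smooth h2 ->
  grad (fun x => h1 x + c * h2 x) x = grad h1 x + c *: grad h2 x.
Proof.
move=> s1 s2; apply/rowP => j; rewrite !mxE.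
rewrite deriveD; last 2 first.
- exact: smooth_derivable.
- by apply: derivableZ; exact: smooth_derivable.
by congr (_ + _); apply: (deriveZ c); exact: smooth_derivable.
Qed.

Lemma grad_sum (I : Type) (s : seq I) (c : I -> R) (h : I -> 'cV[R]_n -> R) x :
  (forall i, smooth (h i)) ->
  grad (fun x => \sum_(i <- s) c i * h i x) x = \sum_(i <- s) c i *: grad (h i) x.
Proof.
move=> hs; elim: s => [|i s IH].
  by rewrite big_nil; under eq_fun do rewrite big_nil; exact: grad_cst.
rewrite big_cons -IH addrC; under eq_fun do rewrite big_cons addrC.
apply: grad_lin => //; apply: smooth_sum => k.
by apply: smoothM => //; exact: smooth_cst.
Qed.

Variable f : 'cV[R]_n -> 'cV[R]_n.
Hypothesis fs : smooth f.

Lemma smooth_Lf h : smooth h -> smooth (Lf f h).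
Proof.
move=> hs; have -> : Lf f h = (fun x => \sum_j 'D_(basis_vec j) h x * f x j 0).
  by apply/funext => x; rewrite /Lf mxE; apply: eq_bigr => j _; rewrite mxE.
apply: smooth_sum => j; apply: smoothM; first exact: smooth_derive.
exact: smooth_coord.
Qed.

Lemma smooth_iterLf h k : smooth h -> smooth (iter k (Lf f) h).
Proof. by move=> hs; elim: k => // k; exact: smooth_Lf. Qed.

Lemma smooth_psi m (nu : 'I_m -> nat -> R) h i k : smooth h -> smooth (psi f nu i h k).
Proof.
move=> hs; elim: k => // k IH /=; apply: smoothB; first exact: smooth_Lf.
by apply: smoothM => //; exact: smooth_cst.
Qed.

End Smooth.

(** * Invariance of the safe set *)

(** If [w T < 0], then [w] is negative after the last time at which it is nonnegative, hence
    nondecreasing from there on, so it cannot have reached [w T]. *)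
Lemma ge0_of_derive_ge0 {R : realType} (w dw : R -> R) (T : R) : 0 <= T ->
  {within `[0, T], continuous w} -> 0 <= w 0 ->
  (forall c, 0 < c < T -> is_derive c 1 w (dw c)) ->
  (forall c, 0 < c < T -> w c < 0 -> 0 <= dw c) ->
  0 <= w T.
Proof.
move=> T0 cw w0 hw hdw; rewrite leNgt; apply/negP => wT.
pose A := [set t | 0 <= t <= T /\ 0 <= w t].
have A0 : A 0 by split; rewrite ?lexx.
have hsA : has_sup A by split; [exists 0|exists T => t [/andP[_]]].
have s0 : 0 <= sup A by apply: ub_le_sup => //; case: hsA.
have sT : sup A <= T by apply: ge_sup; [exists 0|move=> t [/andP[_]]].
have ws : 0 <= w (sup A).
  rewrite leNgt; apply/negP => ws; move/subspace_continuousP : cw.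
  have sI : `[0, T]%classic (sup A) by rewrite /= in_itv/= s0.
  move=> /(_ _ sI)/cvgrPdist_lt/(_ _ (_ : 0 < - w (sup A))).
  rewrite oppr_gt0 => /(_ ws)[d /= d0 hd].
  have [t At tS] := sup_adherent d0 hsA; have [tI wt] := At.
  have tA : t <= sup A by apply: ub_le_sup => //; case: hsA.
  have : `|w (sup A) - w t| < - w (sup A).
    by apply: hd; rewrite /= ?in_itv//= ger0_norm ?subr_ge0//; lra.
  by rewrite ltr_norml => /andP[]; lra.
have sub : `[sup A, T] `<=` `[0, T].
  by move=> t /=; rewrite !in_itv/= => /andP[/(le_trans s0)-> ->].
have := @mean_value_le R (cst 0) w (cst 0) dw _ _ sT.
rewrite subrr; move=> h; suff : 0 <= w T - w (sup A) by lra.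
apply: h.
- by move=> c /andP[c1 c2]; apply: hw; rewrite (le_lt_trans s0 c1).
- by move=> x; exact: cvg_cst.
- exact: continuous_subspaceW sub cw.
move=> c /andP[c1 c2]; apply: hdw; first by rewrite (le_lt_trans s0 c1).
rewrite ltNge; apply/negP => wc; have : c <= sup A; last by rewrite leNgt c1.
apply: ub_le_sup; first by case: hsA.
by split => //; rewrite (le_trans s0 (ltW c1)) ltW.
Qed.

Section SafeSet.
Context {R : realType} {n m : nat}.
Variables (f : 'cV[R]_n -> 'cV[R]_n) (g : 'cV[R]_n -> 'M[R]_(n, m)).
Variables (y : 'cV[R]_n -> 'cV[R]_m) (r : 'I_m -> nat).
Variables (alpha nu : 'I_m -> nat -> R) (ymin ymax : 'I_m -> R).
Variables (E : set 'cV[R]_n) (kd : 'cV[R]_n -> R -> 'cV[R]_m).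
Hypothesis fs : smooth f.
Hypothesis ys : smooth y.
Hypothesis vrd : vector_relative_degree_on f g y r E.
Hypothesis gns : gains r alpha nu.
Hypothesis alpha1 : forall i, 0 < alpha i 1%N.
Hypothesis ylt : forall i, ymin i < ymax i.

Local Notation ctrl := (controller f g y r alpha ymin ymax kd).
Local Notation F := (closed_loop f g y r alpha ymin ymax kd).
Implicit Types (x : 'cV[R]_n) (i : 'I_m).

Lemma smooth_output i : smooth (output y i).
Proof. exact: smooth_coord. Qed.

(** The operators [Lf - nu] compose like polynomials in [Lf]: [psi] at index [j] is [Q i j]
    evaluated at [Lf] and applied to [h], and [Q i (r i)] is the product occurring in [gains]. *)
Let Q i j : {poly R} := \prod_(1 <= l < j.+1) ('X - (nu i l)%:P).

Let size_Q i j : size (Q i j) = j.+1.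
Proof. by rewrite /Q size_prod_XsubC size_iota subn1. Qed.

Let Q_lead i j : (Q i j)`_j = 1.
Proof.
have /monicP := monic_prod_XsubC (index_iota 1 j.+1) xpredT (nu i).
by rewrite lead_coefE -/(Q i j) size_Q.
Qed.

Let Q_recr i j k : (Q i j.+1)`_k =
  (if k is k'.+1 then (Q i j)`_k' else 0) - nu i j.+1 * (Q i j)`_k.
Proof.
rewrite /Q big_nat_recr//= -/(Q i j) mulrBr coefB coefMX coefMC mulrC.
by case: k.
Qed.

(** The range [N] is any number above the degree, the extra coefficients being 0; with [N] fixed,
    the induction on [j] never changes the range of summation. *)
Lemma psiE i h j N : smooth h -> (j < N)%N ->
  psi f nu i h j = fun x => \sum_(k < N) (Q i j)`_k * iter k (Lf f) h x.
Proof.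
move=> hs; elim: j => [|j IH] jN; apply/funext => x /=.
  case: N jN => // N _; rewrite big_ord_recl /= big1 => [|k _].
    by rewrite Q_lead mul1r addr0.
  by rewrite nth_default ?mul0r// size_Q.
rewrite (IH (ltnW jN)).
have -> : Lf f (fun x => \sum_(k < N) (Q i j)`_k * iter k (Lf f) h x) x =
    \sum_(k < N) (Q i j)`_k * iter k.+1 (Lf f) h x.
  rewrite /Lf grad_sum; last by move=> k; exact: smooth_iterLf.
  rewrite mulmx_suml summxE; apply: eq_bigr => k _.
  by rewrite -scalemxAl mxE.
rewrite mulr_sumr -sumrB; under [RHS]eq_bigr do rewrite Q_recr mulrBl.
rewrite !sumrB; congr (_ - _); last by apply: eq_bigr => k _; rewrite mulrA.
case: N jN {IH} => // N jN.
rewrite big_ord_recr [RHS]big_ord_recl /= mul0r add0r nth_default ?size_Q//.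
by rewrite mul0r addr0.
Qed.

Section Barrier.
(** The sign [s] is 1 for [h_low] and -1 for [h_up], so one argument serves both barriers. *)
Variables (i : 'I_m) (h : 'cV[R]_n -> R) (s : R).
Hypothesis hs : smooth h.
Hypothesis gradh : forall x, grad h x = s *: grad (output y i) x.

Lemma grad_iterLf k x :
  grad (iter k (Lf f) h) x = s *: grad (LfI f y k i) x.
Proof.
elim: k x => [|k IH] x; first exact: gradh.
have -> : iter k.+1 (Lf f) h = (fun x => 0 + s * LfI f y k.+1 i x).
  by apply/funext => z; rewrite /= add0r [LHS]/Lf IH -scalemxAl mxE.
have sL : smooth (LfI f y k.+1 i) by exact/smooth_iterLf/smooth_output.
by rewrite (grad_lin _ _ (smooth_cst 0) sL) grad_cst add0r.
Qed.

Lemma iterLf_barrier k x : iter k.+1 (Lf f) h x = s * LfI f y k.+1 i x.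
Proof. by rewrite [LHS]/Lf grad_iterLf -scalemxAl mxE. Qed.

(** The relative degree annihilates [Lg] on all Lie derivatives of order below [r i - 1]. Only the
    leading term of the monic polynomial [Q i j] can meet the input, and only when [j] is
    [r i - 1]. *)
Lemma Lg_psi j x : E x -> (j < r i)%N ->
  Lg g (psi f nu i h j) x =
    if j.+1 == r i then s *: (b_ f g y r i x)^T else 0.
Proof.
move=> Ex jr; have [rpos Lg0 _] := vrd Ex.
rewrite (psiE _ hs (ltnSn j)) /Lg grad_sum; last by move=> k; exact: smooth_iterLf.
rewrite mulmx_suml big_ord_recr /= big1 ?add0r => [|k _]; last first.
  rewrite grad_iterLf -scalemxAl -scalemxAl -/(Lg g (LfI f y k i) x) Lg0 ?scaler0//.
  by rewrite addn2 (leq_ltn_trans _ jr)// ltn_ord.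
rewrite Q_lead scale1r grad_iterLf -scalemxAl -/(Lg g (LfI f y j i) x).
case: eqP => [jE|/eqP jne]; last first.
  by rewrite Lg0 ?scaler0// addn2 ltn_neqAle jne.
by rewrite /b_ trmxK /decoupling rowK -jE.
Qed.

Lemma psi_along j x u : E x -> (j < r i)%N ->
  (grad (psi f nu i h j) x *m (f x + g x *m u)) 0 0 =
    psi f nu i h j.+1 x + nu i j.+1 * psi f nu i h j x +
    (if j.+1 == r i then s * ((b_ f g y r i x)^T *m u) 0 0 else 0).
Proof.
move=> Ex jr; rewrite mulmxDr mxE mulmxA -/(Lg g (psi f nu i h j) x) Lg_psi//.
rewrite /= subrK; congr (_ + _).
by case: ifP => _; rewrite ?mul0mx -?scalemxAl mxE.
Qed.

(** By [gains] the lower coefficients of [Q i (r i)] are the [alpha]. Positive-order Lie derivatives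
    of [h] are [s] times those of the output, but order zero retains the constant offset of [h],
    which is why the sum in [a_] starts at order 1 and the first gain stands apart. *)
Lemma psi_top x : (0 < r i)%N ->
  psi f nu i h (r i) x = s * a_ f y r alpha i x + alpha i 1%N * h x.
Proof.
move=> r0; have [QE _] := gns i.
have cE k : (Q i (r i))`_k =
    (k == r i)%:R + (if (k < r i)%N then alpha i k.+1 else 0).
  by rewrite /Q -QE -(poly_def (r i) (fun j => alpha i j.+1)) coefD coefXn coef_poly.
rewrite (psiE _ hs (ltnSn (r i))) /a_ big_ord_recr /= cE eqxx ltnn addr0 mul1r.
rewrite -[r i in LHS](prednK r0) iterLf_barrier prednK//.
have -> : \sum_(k < r i) (Q i (r i))`_k * iter k (Lf f) h x =
    alpha i 1%N * h x + \sum_(1 <= k < r i) s * (alpha i k.+1 * LfI f y k i x).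
  rewrite -(big_mkord xpredT (fun k => (Q i (r i))`_k * iter k (Lf f) h x)).
  rewrite big_ltn// cE r0 ltn_eqF// add0r; congr (_ + _).
  rewrite big_nat [RHS]big_nat; apply: eq_bigr => -[|k]// /andP[_ kr].
  by rewrite cE kr ltn_eqF// add0r iterLf_barrier mulrCA.
by rewrite -mulr_sumr; ring.
Qed.

(** The indices are treated downwards. At [r i - 1] the hypothesis on [ctrl] makes [psi_top] plus
    the input term nonnegative; at a lower index no input appears, and the next [psi] is already
    known to be nonnegative. *)
Lemma psi_invariant (x : R -> 'cV[R]_n) (c : R -> R) (T : R) : 0 <= T ->
  {within `[0, T], continuous x} ->
  (forall t, 0 < t < T -> [/\ 0 <= c t, c t != 0 -> E (x t) &
    diff_quotient x t @ t^' --> c t *: F (x t) t]) ->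
  (forall z t, E z -> 0 <= s * (a_ f y r alpha i z +
     ((b_ f g y r i z)^T *m ctrl z t) 0 0) + alpha i 1%N * h z) ->
  (forall j, (j < r i)%N -> 0 <= psi f nu i h j (x 0)) ->
  forall j, (j < r i)%N -> forall t, 0 <= t <= T -> 0 <= psi f nu i h j (x t).
Proof.
move=> T0 cx dx top psi0.
have step j : (j < r i)%N ->
    ((j.+1 < r i)%N -> forall t, 0 <= t <= T -> 0 <= psi f nu i h j.+1 (x t)) ->
    forall t, 0 <= t <= T -> 0 <= psi f nu i h j (x t).
  move=> jr next t /andP[t0 tT]; have psis := smooth_psi fs nu i j hs.
  have sub : `[0, t] `<=` `[0, T].
    by move=> c' /=; rewrite !in_itv/= => /andP[-> /le_trans->].
  have inT t' : 0 < t' < t -> 0 < t' < T.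
    by move=> /andP[-> /lt_le_trans->].
  apply: (@ge0_of_derive_ge0 R (psi f nu i h j \o x) (fun t =>
    c t * (grad (psi f nu i h j) (x t) *m F (x t) t) 0 0) t t0).
  - apply/subspace_continuousP => t' t'I.
    have /subspace_continuousP/(_ _ t'I) ct := continuous_subspaceW sub cx.
    by have [pc _] := psis 0%N; exact: (cvg_comp _ _ ct (pc (x t'))).
  - exact: psi0.
  - move=> t' /inT t'T; have [_ _ hx] := dx t' t'T.
    have := smooth_chain psis _ hx; case/andP: t'T => t'0 _ => /(_ t'0).
    by rewrite -scalemxAr mxE.
  move=> t' /inT t'T neg; have [c0 cE _] := dx t' t'T.
  have [->|/cE Ex] := eqVneq (c t') 0; first by rewrite mul0r.
  rewrite mulr_ge0// psi_along//.
  have jr1 : (1 <= j.+1 <= r i)%N by rewrite jr.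
  have nu_neg : 0 <= nu i j.+1 * psi f nu i h j (x t').
    by rewrite mulr_le0// ltW//; have [_] := gns i; exact.
  case: eqP => [jE|/eqP jne].
    have := top (x t') t' Ex; rewrite jE psi_top ?(leq_trans _ jr)// -jE; lra.
  rewrite addr0 addr_ge0//; apply: next; first by rewrite ltn_neqAle jne.
  by case/andP: t'T => /ltW-> /ltW->.
(* Here [d] is the distance from [j] to the top index [r i - 1]. *)
suff main d : forall j, (j < r i)%N -> (j + d)%N = (r i).-1 ->
    forall t, 0 <= t <= T -> 0 <= psi f nu i h j (x t).
  by move=> j jr; apply: (main ((r i).-1 - j)%N) => //; lia.
elim: d => [|d IH] j jr jd; apply: step => // jr'; first by lia.
by apply: IH => //; lia.
Qed.

End Barrier.

(** Since [b_ i] is the transposed decoupling matrix applied to the i-th unit vector, and B G^-1 B^T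
    is the identity, each summand of [kcbf] acts on a single output channel. *)
Lemma mul_decoupling_gram x i : decoupling f g y r x \in unitmx ->
  decoupling f g y r x *m (invmx (gramB f g y r x) *m b_ f g y r i x) =
    delta_mx i 0.
Proof.
set B := decoupling f g y r x => Bu.
have Gu : gramB f g y r x \in unitmx by rewrite unitmx_mul unitmx_tr Bu.
have bE : b_ f g y r i x = B^T *m delta_mx i 0.
  by rewrite /b_ -/B rowE trmx_mul trmx_delta.
have GBB : invmx (gramB f g y r x) *m B^T *m B = 1%:M.
  by rewrite -mulmxA mulVmx.
by rewrite bE mulmxA mulmxA -(mulmxA B) (mulmx1C GBB) mul1mx.
Qed.

Lemma b_kcbf x t i : E x ->
  ((b_ f g y r i x)^T *m kcbf f g y r alpha ymin ymax kd x t) 0 0 =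
    lambda_low f g y r alpha ymin kd i x t - lambda_up f g y r alpha ymax kd i x t.
Proof.
move=> /vrd[_ _ Bu]; rewrite /b_ trmxK -row_mul mxE /kcbf mulmx_sumr summxE.
rewrite (bigD1 i)//= big1 ?addr0 => [|k ki].
  by rewrite -scalemxAr mul_decoupling_gram// !mxE !eqxx mulr1.
by rewrite -scalemxAr mul_decoupling_gram// !mxE eq_sym (negbTE ki) mulr0.
Qed.

Lemma b_controller x t i : E x ->
  0 <= a_ f y r alpha i x + ((b_ f g y r i x)^T *m ctrl x t) 0 0
       + alpha i 1%N * (output y i x - ymin i) /\
  0 <= - (a_ f y r alpha i x + ((b_ f g y r i x)^T *m ctrl x t) 0 0)
       + alpha i 1%N * (ymax i - output y i x).
Proof.
move=> Ex; rewrite /controller mulmxDr mxE b_kcbf// /lambda_low /lambda_up.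
have : alpha i 1%N * (output y i x - ymax i) < alpha i 1%N * (output y i x - ymin i).
  by rewrite ltr_pM2l// ltrD2l ltrN2.
rewrite -(opprB (output y i x)) mulrN.
set p := alpha i 1%N * (_ - ymax i); set q := alpha i 1%N * (_ - ymin i) => pq.
move: (a_ f y r alpha i x) (((b_ f g y r i x)^T *m kd x t) 0 0) => a b.
(* An active correction turns its own inequality into an equality and leaves the slack [q - p] in
   the other; if neither is active, both inequalities are the negated guards. *)
by case: (leP 0 (- a - q - b)) => ?; case: (leP 0 (a + p + b)) => ?; split; lra.
Qed.

(** The factor [c] will be the cutoff along a Picard solution in the existence proof, and constantly
    1 for a given closed-loop solution in the uniqueness proof. *)
Lemma safe_set_invariant (x : R -> 'cV[R]_n) (c : R -> R) (T : R) : 0 <= T ->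
  {within `[0, T], continuous x} ->
  (forall t, 0 < t < T -> [/\ 0 <= c t, c t != 0 -> E (x t) &
    diff_quotient x t @ t^' --> c t *: F (x t) t]) ->
  safe_set f y r nu ymin ymax (x 0) -> safe_set f y r nu ymin ymax (x T).
Proof.
move=> T0 cx dx Sx0 i _; have [low0 up0] := Sx0 i I.
have TT : 0 <= T <= T by rewrite T0 lexx.
have sy := smooth_output i.
split=> j /= jr.
  apply: (@psi_invariant i (h_low y ymin i) 1 _ _ x c T) => //.
  - by apply: smoothB => //; exact: smooth_cst.
  - move=> z.
    have -> : h_low y ymin i = (fun w => - ymin i + 1 * output y i w).
      by apply/funext => w; rewrite mul1r addrC.
    by rewrite (grad_lin _ _ (smooth_cst _) sy) grad_cst add0r.
  - by move=> z t Ez; rewrite mul1r; have [] := b_controller t i Ez.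
apply: (@psi_invariant i (h_up y ymax i) (-1) _ _ x c T) => //.
- by apply: smoothB => //; exact: smooth_cst.
- move=> z.
  have -> : h_up y ymax i = (fun w => ymax i + (-1) * output y i w).
    by apply/funext => w; rewrite mulN1r.
  by rewrite (grad_lin _ _ (smooth_cst _) sy) grad_cst add0r.
- by move=> z t Ez; rewrite mulN1r; have [] := b_controller t i Ez.
Qed.

End SafeSet.

(** * Cutoff of the closed-loop field *)

Section Cutoff.
Context {R : realType} {n : nat}.
Variables (S E : set 'cV[R]_n) (F : 'cV[R]_n -> R -> 'cV[R]_n) (T : R).
Hypothesis cS : compact S.
Hypothesis S0 : S !=set0.
Hypothesis oE : open E.
Hypothesis SE : S `<=` E.
Hypothesis T0 : 0 <= T.
Hypothesis Flip : forall x t, S x -> 0 <= t <= T ->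
  lip_near [set p : 'cV[R]_n * R | 0 <= p.2] (x, t) (fun p => F p.1 p.2).

Let uniform_lip : exists N d : R, [/\ 0 < N, 0 < d,
  forall x z, S x -> `|z - x| < d -> E z &
  forall x t, S x -> 0 <= t <= T ->
    lip_ball [set p : 'cV[R]_n * R | 0 <= p.2] (x, t) (fun p => F p.1 p.2) N d].
Proof.
have cK : compact (S `*` `[0, T]%classic).
  by apply: compact_setX => //; exact: segment_compact.
(* One natural number governs both scales: the constant [N.+1] grows while the radius shrinks as its
   inverse, so every local condition holds for all large [N], as the covering form of compactness
   requires. *)
move/compact_near_coveringP : cK => /(_ nat \oo (fun N p =>
  (forall z, `|z - p.1| < N.+1%:R^-1 -> E z) /\
  lip_ball [set p : 'cV[R]_n * R | 0 <= p.2] p (fun p => F p.1 p.2)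
    N.+1%:R N.+1%:R^-1) _).
have H : forall p, (S `*` `[0, T]%classic) p -> \forall p' \near p & N \near \oo,
    (forall z, `|z - p'.1| < N.+1%:R^-1 -> E z) /\
    lip_ball [set p : 'cV[R]_n * R | 0 <= p.2] p' (fun p => F p.1 p.2)
    N.+1%:R N.+1%:R^-1.
  move=> [x t] [/= Sx]; rewrite in_itv/= => tT.
  have [L [d [L0 d0 hL]]] := Flip Sx tT.
  have /nbhs_ballP[e /= e0 he] : nbhs x E by apply: open_nbhs_nbhs; split => //; exact: SE.
  rewrite -ball_normE /= in he.
  (* A ball of radius [u] whose centre is displaced by less than [u] stays inside both given
     balls. *)
  pose u := Num.min d e / 2.
  have u0 : 0 < u by rewrite divr_gt0// lt_min d0.
  have ud : u + u <= d by rewrite /u -splitr ge_min lexx.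
  have ue : u + u <= e by rewrite /u -splitr ge_min lexx orbT.
  near=> p' N.
  have pu : `|p' - (x, t)| < u.
    rewrite distrC; near: p'; apply/nbhs_ballP; exists u => //=.
    by rewrite ball_prod_normE.
  have NL : L <= N.+1%:R.
    apply: (@le_trans _ _ N%:R); last by rewrite ler_nat.
    by near: N; exact: nbhs_infty_ger.
  have Nu : N.+1%:R^-1 <= u.
    apply: ltW; near: N; exact: (near_infty_natSinv_lt (PosNum u0)).
  have px : `|p'.1 - x| < u.
    by apply: le_lt_trans pu; rewrite [leRHS]prod_normE/= le_max lexx.
  split=> [z zp|q q0 qp].
    apply: he; rewrite /= distrC.
    have := ler_distD p'.1 z x; have := lt_le_trans zp Nu => {zp Nu NL}; lra.
  have near_p q' : `|q' - p'| < N.+1%:R^-1 -> `|q' - (x, t)| < d.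
    move=> h; have := ler_distD p' q' (x, t).
    have := lt_le_trans h Nu => {h qp Nu NL}; lra.
  have [h1 h2] := hL q q0 (near_p _ qp).
  split=> [|q' q0' qp']; first exact: le_trans NL.
  apply: le_trans (h2 _ q0' (near_p _ qp')) _.
  by rewrite ler_wpM2r.
move=> /(_ H)[N _ /(_ N (leqnn N))hN].
exists N.+1%:R, N.+1%:R^-1; split => //.
  move=> x z Sx zx; have [|h _] := hN (x, 0); last exact: h.
  by split => //=; rewrite in_itv/= lexx.
by move=> x t Sx tT; have [] := hN (x, t).
Unshelve. all: by end_near. Qed.

Lemma cutoff_field : exists (chi : 'cV[R]_n -> R)
    (H : 'cV[R]_n * R -> 'cV[R]_n) (L M : R),
  [/\ [/\ 1 <= L, 0 <= M, forall p q, `|H p - H q| <= L * `|p - q| &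
      forall p, `|H p| <= M],
    [/\ forall x, 0 <= chi x, forall x, S x -> chi x = 1 &
      forall x, chi x != 0 -> E x] &
    forall x t, 0 <= t <= T -> H (x, t) = chi x *: F x t].
Proof.
have [N [d [N0 d0 hE hF]]] := uniform_lip.
(* A point with [chi] nonzero is within [e] of some [s] in [S], and a point within [e] of it is
   still within [d] of the same [s], where [F] has constant [N]. *)
pose e := d / 2; have e0 : 0 < e by rewrite divr_gt0.
have de : d = e + e by rewrite /e -splitr.
(* The supremum of these tents over [s] in [S] is the tent function of the distance to [S], with
   Lipschitz constant [e^-1]. *)
pose bump (x s : 'cV[R]_n) := Num.max 0 (1 - `|x - s| / e).
have bump1 x s : 0 <= bump x s <= 1.
  rewrite le_max lexx/= ge_max ler01/= gerBl divr_ge0//; exact: ltW.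
pose B x := [set bump x s | s in S].
have hB x : has_sup (B x).
  have [s Ss] := S0; split; first by exists (bump x s), s.
  by exists 1 => _ [s' _ <-]; case/andP: (bump1 x s').
pose chi x := sup (B x).
have bump_chi x s : S s -> bump x s <= chi x.
  by move=> Ss; apply: ub_le_sup; [case: (hB x)|exists s].
have chi_le x c : (forall s, S s -> bump x s <= c) -> chi x <= c.
  by move=> h; apply: ge_sup; [case: (hB x)|move=> _ [s Ss <-]; exact: h].
have chi0 x : 0 <= chi x.
  by have [s Ss] := S0; apply: le_trans (bump_chi x s Ss); case/andP: (bump1 x s).
have chi1 x : chi x <= 1 by apply: chi_le => s _; case/andP: (bump1 x s).
have chiS x : S x -> chi x = 1.
  move=> Sx; apply/eqP; rewrite eq_le chi1/=; apply: le_trans (bump_chi x x Sx).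
  by rewrite /bump subrr normr0 mul0r subr0 le_max lexx orbT.
have chi_near x : chi x != 0 -> exists2 s, S s & `|x - s| < e.
  move=> cx; apply: contrapT => hn; case/negP: cx.
  rewrite eq_le chi0 andbT; apply: chi_le => s Ss.
  rewrite ge_max lexx/= subr_le0 ler_pdivlMr// mul1r leNgt.
  by apply/negP => h; apply: hn; exists s.
have chi_lip x x' : `|chi x - chi x'| <= `|x - x'| / e.
  have half z z' : chi z <= chi z' + `|z - z'| / e.
    apply: chi_le => s Ss; have h := bump_chi z' s Ss.
    have zs : 0 <= `|z - z'| / e by rewrite divr_ge0// ltW.
    have tri : `|z' - s| / e <= `|z - s| / e + `|z - z'| / e.
      rewrite -mulrDl ler_pM2r ?invr_gt0// [leRHS]addrC [`|z - z'|]distrC.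
      exact: ler_distD.
    rewrite ge_max; apply/andP; split; first by rewrite addr_ge0.
    have : 1 - `|z' - s| / e <= chi z'.
      by apply: le_trans h; rewrite le_max lexx orbT.
    lra.
  have := half x x'; have := half x' x; rewrite [`|x' - x|]distrC ler_norml.
  by move=> ? ?; apply/andP; split; lra.
(* Freezing time outside [[0, T]] makes [H] Lipschitz on the whole real time line, as Picard
   iteration demands. *)
pose clamp (t : R) := Num.min T (Num.max 0 t).
have clampT t : 0 <= clamp t <= T.
  by rewrite le_min T0 le_max lexx/= ge_min lexx.
have clamp_lip t t' : `|clamp t - clamp t'| <= `|t - t'|.
  have lmax (a b c : R) : `|Num.max c a - Num.max c b| <= `|a - b|.
    have := ler_norm (a - b); have := ler_norm (b - a).
    rewrite [`|b - a|]distrC ler_norml.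
    by case: (leP c a) => ?; case: (leP c b) => ? ? ?; apply/andP; split; lra.
  have lmin (a b c : R) : `|Num.min c a - Num.min c b| <= `|a - b|.
    have := ler_norm (a - b); have := ler_norm (b - a).
    rewrite [`|b - a|]distrC ler_norml.
    by case: (leP c a) => ?; case: (leP c b) => ? ? ?; apply/andP; split; lra.
  exact: le_trans (lmin _ _ _) (lmax _ _ _).
pose H (p : 'cV[R]_n * R) := chi p.1 *: F p.1 (clamp p.2).
have Fbnd x s t : S s -> `|x - s| < d -> `|F x (clamp t)| <= N.
  move=> Ss xs; have /andP[c0 _] := clampT t.
  have [] // := hF s (clamp t) Ss (clampT t) (x, clamp t) c0.
  by rewrite prod_normE/= subrr normr0 gt_max xs.
have Hbnd p : `|H p| <= N.
  rewrite /H normrZ ger0_norm//.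
  have [->|/chi_near[s Ss ps]] := eqVneq (chi p.1) 0.
    by rewrite mul0r ltW.
  rewrite -[leRHS]mul1r ler_pM//; apply: Fbnd Ss _.
  by rewrite de (lt_le_trans ps)// lerDl ltW.
(* Only [p] has to lie where [chi] is nonzero, so pairs that straddle the edge of the support are
   covered too. *)
have Hnear p q : chi p.1 != 0 -> `|p - q| < e ->
    `|H p - H q| <= (N + N / e) * `|p - q|.
  move=> /chi_near[s Ss ps] pq.
  have pq1 : `|p.1 - q.1| <= `|p - q| by rewrite [leRHS]prod_normE le_max lexx.
  have pq2 : `|p.2 - q.2| <= `|p - q|.
    by rewrite [leRHS]prod_normE le_max lexx orbT.
  have qs : `|q.1 - s| < d.
    have := ler_distD p.1 q.1 s; rewrite [`|q.1 - p.1|]distrC; lra.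
  have psd : `|p.1 - s| < d by lra.
  have /andP[cp0 _] := clampT p.2; have /andP[cq0 _] := clampT q.2.
  have psn : `|(p.1, clamp p.2) - (s, clamp p.2)| < d.
    by rewrite prod_normE/= subrr normr0 gt_max psd.
  have [_ /(_ (q.1, clamp q.2) cq0)] :=
    hF s (clamp p.2) Ss (clampT _) (p.1, clamp p.2) cp0 psn.
  have cqp : `|clamp q.2 - clamp p.2| <= `|p - q|.
    by rewrite distrC; exact: le_trans (clamp_lip _ _) pq2.
  rewrite !prod_normE/= gt_max qs/= => hFl.
  have {}hFl : `|F p.1 (clamp p.2) - F q.1 (clamp q.2)| <= N * `|p - q|.
    apply: le_trans (hFl _) _; first lra.
    by rewrite ler_wpM2l ?(ltW N0)// ge_max pq1 distrC.
  have -> : H p - H q = chi p.1 *: (F p.1 (clamp p.2) - F q.1 (clamp q.2)) +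
      (chi p.1 - chi q.1) *: F q.1 (clamp q.2).
    by rewrite /H scalerBr scalerBl addrA subrK.
  apply: le_trans (ler_normD _ _) _; rewrite !normrZ mulrDl lerD//.
    rewrite (ger0_norm (chi0 _)) -[leRHS]mul1r; exact: ler_pM.
  have hq := Fbnd q.1 s q.2 Ss qs.
  apply: (@le_trans _ _ (`|p - q| / e * N)); last by rewrite mulrC mulrA mulrAC.
  apply: ler_pM => //; apply: le_trans (chi_lip _ _) _.
  by rewrite ler_pM2r// invr_gt0.
(* The summand 1 gives [1 <= L], [N + N / e] serves pairs closer than [e], and [(N + N) / e] serves
   distant pairs, for which the bound [N + N] on the difference is enough. *)
exists chi, H, (1 + (N + N / e) + (N + N) / e), N; split.
- have Ne : 0 <= N / e by rewrite ltW// divr_gt0.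
  have NNe : 0 <= (N + N) / e by rewrite ltW// divr_gt0// addr_gt0.
  split => //; [lra|exact: ltW|move=> p q].
  have pq0 := normr_ge0 (p - q).
  have A1 : 0 <= N * `|p - q| by rewrite mulr_ge0// ltW.
  have A2 : 0 <= N / e * `|p - q| by rewrite mulr_ge0.
  have A3 : 0 <= (N + N) / e * `|p - q| by rewrite mulr_ge0.
  have [pe|pe] := leP e `|p - q|.
    have : `|H p - H q| <= N + N by rewrite (le_trans (ler_normB _ _))// lerD.
    have : N + N <= (N + N) / e * `|p - q|.
      rewrite -mulrA -[leLHS]mulr1; apply: ler_wpM2l.
        by rewrite ltW// addr_gt0.
      by rewrite ler_pdivlMl// mulr1.
    lra.
  have [p0|pn0] := eqVneq (chi p.1) 0; last first.
    have := Hnear p q pn0 pe; lra.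
  have [q0|qn0] := eqVneq (chi q.1) 0.
    rewrite /H p0 q0 !scale0r subrr normr0; lra.
  have := Hnear q p qn0; rewrite !(distrC q) (distrC (H q)) => /(_ pe); lra.
- split => // x /chi_near[s Ss xs]; apply: hE Ss _.
  by rewrite de (lt_le_trans xs)// lerDl ltW.
move=> x t /andP[t0 tT]; rewrite /H /= /clamp (max_idPr t0).
by rewrite (min_idPr tT).
Qed.

End Cutoff.

(** * Closed-loop solutions *)

Lemma locally_lipschitz_lip_near {R : realType} {U W : normedModType R}
    (A : set U) (p : U) (K : U -> W) :
  [locally [lipschitz K q | q in A]] -> A p -> lip_near A p K.
Proof.
move=> hK Ap; have := hK (p, p) (conj Ap Ap).
move=> [M [_ hM]]; pose N := Num.max 0 M + 1.
have N0 : 0 < N by rewrite ltr_wpDl// le_max lexx.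
have NM : M < N by rewrite (@le_lt_trans _ _ (Num.max 0 M)) ?ltrDl// le_max lexx orbT.
have /nbhs_ballP[d /= d0] := hM N NM; rewrite ball_prod_normE => hd.
have hlip q q' : A q -> A q' -> `|q - p| < d -> `|q' - p| < d ->
    `|K q - K q'| <= N * `|q - q'|.
  move=> Aq Aq' qd qd'; apply: (hd (q, q')) => //=.
  by rewrite prod_normE/= gt_max !(distrC p) qd.
exists (N + N * d + `|K p|), d; split => //.
  by rewrite ltr_wpDr// addr_gt0// mulr_gt0.
have Nd : 0 <= N * d by rewrite mulr_ge0// ltW.
move=> q Aq qd; split=> [|q' Aq' qd'].
  have := hlip q p Aq Ap qd; rewrite subrr normr0 => /(_ d0) h.
  have := ler_distD (K p) (K q) 0; rewrite !subr0 => h'.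
  have : N * `|q - p| <= N * d by rewrite ler_pM2l// ltW.
  lra.
apply: le_trans (hlip q q' Aq Aq' qd qd') _; rewrite ler_wpM2r//.
have := normr_ge0 (K p); lra.
Qed.

Section Enorm.
Context {R : realType} {p q : nat}.
Implicit Types A : 'M[R]_(p, q).

Lemma enorm_ge0 A : 0 <= enorm A.
Proof. exact: sqrtr_ge0. Qed.

Lemma enorm_sqr A : enorm A ^+ 2 = \sum_i \sum_j A i j ^+ 2.
Proof.
by rewrite sqr_sqrtr// sumr_ge0// => i _; rewrite sumr_ge0// => j _; exact: sqr_ge0.
Qed.

End Enorm.

Lemma mulmx_young {R : realType} {p : nat} (w : 'rV[R]_p) (v : 'cV[R]_p) (s : R) :
  0 < s -> (w *m v) 0 0 <= s * enorm w ^+ 2 + enorm v ^+ 2 / (4 * s).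
Proof.
move=> s0; rewrite !enorm_sqr mxE big_ord1 mulr_sumr mulr_suml -big_split/=.
apply: ler_sum => k _; rewrite big_ord1.
have -> : s * w 0 k ^+ 2 + v k 0 ^+ 2 / (4 * s) =
    w 0 k * v k 0 + (2 * s * w 0 k - v k 0) ^+ 2 / (4 * s).
  by field; rewrite gt_eqF.
by rewrite lerDl divr_ge0 ?sqr_ge0// mulr_ge0// ltW.
Qed.

(** The product of [expR (gamma * t)] and [phi t - K / gamma] is nonincreasing, [K / gamma] being
    the equilibrium of the comparison equation; [0 <= K] allows the remaining negative term to be
    dropped. *)
Lemma gronwall_decay {R : realType} (phi dphi : R -> R) (gamma K T : R) :
  0 <= T -> 0 < gamma -> 0 <= K ->
  {within `[0, T], continuous phi} ->
  (forall c, 0 < c < T -> is_derive c 1 phi (dphi c)) ->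
  (forall c, 0 < c < T -> dphi c <= - gamma * phi c + K) ->
  phi T <= expR (- gamma * T) * phi 0 + K / gamma.
Proof.
move=> T0 g0 K0 cphi hphi hle.
pose E (t : R) := 1 * expR (gamma * t).
have dE (c : R) : is_derive c 1 E (gamma * expR (gamma * c)).
  by have := is_derive_expM 1 gamma c; rewrite mul1r.
pose w t := E t * (phi t - K / gamma).
have := @mean_value_le R w (cst 0)
  (fun c => E c * dphi c + (phi c - K / gamma) * (gamma * expR (gamma * c)))
  (cst 0) 0 T T0.
rewrite subrr => h; have {h} : w T - w 0 <= 0.
  apply: h.
  - move=> c cT; have h1 := is_deriveB (hphi c cT) (is_derive_cst (K / gamma) c 1).
    by have := is_deriveM (dE c) h1; rewrite subr0.
  - move=> x; apply: cvgM; last by apply: cvgB; [exact: cphi|exact: cvg_cst].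
    exact: (derive_continuous_within dE).
  - by move=> x; exact: cvg_cst.
  move=> c cT; have := hle c cT; rewrite /E mul1r => h.
  have -> : expR (gamma * c) * dphi c +
      (phi c - K / gamma) * (gamma * expR (gamma * c)) =
    expR (gamma * c) * (dphi c - (- gamma * phi c + K)).
    by field; rewrite gt_eqF.
  by rewrite mulr_ge0_le0 ?expR_ge0// subr_le0.
rewrite subr_le0 /w /E mulr0 expR0 !mul1r mulNr expRN => h.
have e0 : 0 < expR (gamma * T) by exact: expR_gt0.
have Kg : 0 <= K / gamma by rewrite divr_ge0// ltW.
rewrite -lerBlDr ler_pdivlMl//; apply: le_trans h _; lra.
Qed.

Section ClosedLoop.
Context {R : realType} {n m : nat}.
Variables (f : 'cV[R]_n -> 'cV[R]_n) (g : 'cV[R]_n -> 'M[R]_(n, m)).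
Variables (y : 'cV[R]_n -> 'cV[R]_m) (r : 'I_m -> nat).
Variables (alpha nu : 'I_m -> nat -> R) (ymin ymax : 'I_m -> R).
Variables (E : set 'cV[R]_n) (kd : 'cV[R]_n -> R -> 'cV[R]_m).
Hypothesis fs : smooth f.
Hypothesis gs : smooth g.
Hypothesis ys : smooth y.
Hypothesis vrd : vector_relative_degree_on f g y r E.

Local Notation TT := [set p : 'cV[R]_n * R | 0 <= p.2].
Local Notation F := (closed_loop f g y r alpha ymin ymax kd).

Hypothesis kdlip : [locally [lipschitz kd p.1 p.2 | p in TT]].

Lemma smooth_decoupling i k : smooth (fun x => decoupling f g y r x i k).
Proof.
have -> : (fun x => decoupling f g y r x i k) = (fun x =>
    \sum_j 'D_(basis_vec j) (LfI f y (r i).-1 i) x * g x j k).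
  apply/funext => x; rewrite /decoupling mxE /Lg mxE.
  by apply: eq_bigr => j _; rewrite mxE.
apply: smooth_sum => j; apply: smoothM; last exact: smooth_coord.
by apply: smooth_derive; apply: smooth_iterLf => //; exact: smooth_output.
Qed.

Lemma smooth_a i : smooth (a_ f y r alpha i).
Proof.
have LfIs k : smooth (LfI f y k i) by exact/smooth_iterLf/smooth_output.
apply: smoothD; first exact: LfIs.
by apply: smooth_sum => k; apply: smoothM; [exact: smooth_cst|exact: LfIs].
Qed.

(** Membership in [E] makes [gramB] invertible at the centre, hence its inverse Lipschitz nearby;
    the rest combines smooth data, [kd] and [max] by the closure rules. *)
Lemma closed_loop_lip_near x t : E x -> 0 <= t ->
  lip_near TT (x, t) (fun p => F p.1 p.2).
Proof.
move=> Ex t0; set A := TT; have Axt : A (x, t) by [].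
have sl (h : 'cV[R]_n -> R) : smooth h -> lip_near A (x, t) (fun p => h p.1).
  by move=> hs; exact: smooth_lip_near.
have lc (c : R) : lip_near A (x, t) (fun=> c) by exact: lip_near_cst.
have lkd k : lip_near A (x, t) (fun p => kd p.1 p.2 k 0).
  exact: (lip_near_mxP _ _ _).1 (locally_lipschitz_lip_near kdlip Axt) k 0.
have lB i k : lip_near A (x, t) (fun p => decoupling f g y r p.1 i k).
  exact: (sl _ (smooth_decoupling i k)).
have lb i k : lip_near A (x, t) (fun p => b_ f g y r i p.1 k 0).
  have -> : (fun p : 'cV[R]_n * R => b_ f g y r i p.1 k 0) =
      (fun p => decoupling f g y r p.1 i k).
    by apply/funext => p; rewrite /b_ mxE [LHS]mxE.
  exact: lB.
have lbk i : lip_near A (x, t)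
    (fun p => ((b_ f g y r i p.1)^T *m kd p.1 p.2) 0 0).
  under eq_fun do rewrite mxE; apply: lip_near_sum => k.
  by apply: lip_nearM => //; under eq_fun do rewrite mxE; exact: lb.
have la i := sl _ (smooth_a i).
have ly i := sl _ (smooth_output ys i).
have linv i j : lip_near A (x, t) (fun p => invmx (gramB f g y r p.1) i j).
  apply: lip_near_invmx => // [k l|].
    under eq_fun do rewrite mxE; apply: lip_near_sum => s.
    by apply: lip_nearM => //; under eq_fun do rewrite mxE; exact: lB.
  by have [_ _ Bu] := vrd Ex; rewrite /= unitmx_mul unitmx_tr Bu.
have lcbf k : lip_near A (x, t)
    (fun p => kcbf f g y r alpha ymin ymax kd p.1 p.2 k 0).
  under eq_fun do rewrite summxE; apply: lip_near_sum => i.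
  under eq_fun do rewrite mxE; apply: lip_nearM; last first.
    under eq_fun do rewrite mxE; apply: lip_near_sum => l.
    exact: lip_nearM.
  apply: lip_nearB; apply: lip_near_max0.
    by do ![apply: lip_nearB => //|apply: lip_nearN => //|apply: lip_nearM => //].
  by do ![apply: lip_nearD => //|apply: lip_nearB => //|apply: lip_nearM => //].
apply/lip_near_mxP => i j; rewrite (ord1 j).
under eq_fun do rewrite mxE; apply: lip_nearD; first exact: (sl _ (smooth_coord i 0 fs)).
under eq_fun do rewrite mxE; apply: lip_near_sum => k.
apply: lip_nearM; first exact: (sl _ (smooth_coord i k gs)).
by under eq_fun do rewrite mxE; exact: lip_nearD.
Qed.

Hypothesis gns : gains r alpha nu.
Hypothesis alpha1 : forall i, 0 < alpha i 1%N.
Hypothesis ylt : forall i, ymin i < ymax i.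
Hypothesis oE : open E.
Local Notation S := (safe_set f y r nu ymin ymax).
Hypothesis SE : S `<=` E.
Hypothesis cS : compact S.
Variable x0 : 'cV[R]_n.
Hypothesis Sx0 : S x0.

Let S0 : S !=set0. Proof. by exists x0. Qed.

Let Flip T x t : S x -> 0 <= t <= T -> lip_near TT (x, t) (fun p => F p.1 p.2).
Proof. by move=> Sx /andP[t0 _]; apply: closed_loop_lip_near => //; exact: SE. Qed.

Lemma closed_loop_exists (T : R) : 0 <= T -> exists x : R -> 'cV[R]_n,
  x 0 = x0 /\ forall t, 0 <= t <= T ->
    S (x t) /\ diff_quotient x t @ t^' --> F (x t) t.
Proof.
move=> T0; have [chi [H [L [M [[L1 M0 HL HM] [c0 cS1 cE] HF]]]]] :=
  cutoff_field cS S0 oE SE T0 (@Flip T).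
have [x [xx0 hx]] := picard_exists L1 M0 HL HM x0.
exists x; split => // t /andP[t0 tT].
have Sx : S (x t).
  apply: (@safe_set_invariant R n m f g y r alpha nu ymin ymax E kd fs ys vrd
    gns alpha1 ylt x (chi \o x)) => //; last by rewrite xx0.
    apply/subspace_continuousP => s /=; rewrite in_itv/= => /andP[s0 _].
    apply: (dq_continuous (l := H (x s, s))); apply: cvg_within_filter.
    exact: hx.
  move=> s /andP[s0 st]; split; [exact: c0|exact: cE|].
  have := hx s (ltW s0); rewrite HF//.
  by rewrite (ltW s0) (le_trans (ltW st)).
split => //; have := hx t t0; rewrite HF ?t0//.
by rewrite cS1// scale1r.
Qed.

(** The equation is required in the open interval only, with continuity at the ends, so that
    one-sided solutions on [[0, T[] can be compared with the two-sided ones constructed above. *)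
Lemma closed_loop_unique (T : R) (p q : R -> 'cV[R]_n) : 0 <= T ->
  p 0 = x0 -> q 0 = x0 ->
  {within `[0, T], continuous p} -> {within `[0, T], continuous q} ->
  (forall c, 0 < c < T -> E (p c) /\ diff_quotient p c @ c^' --> F (p c) c) ->
  (forall c, 0 < c < T -> E (q c) /\ diff_quotient q c @ c^' --> F (q c) c) ->
  p T = q T.
Proof.
move=> T0 p0 q0 cp cq hp hq.
have [chi [H [L [M [[L1 M0 HL HM] [_ cS1 _] HF]]]]] :=
  cutoff_field cS S0 oE SE T0 (@Flip T).
have key (z : R -> 'cV[R]_n) : z 0 = x0 -> {within `[0, T], continuous z} ->
    (forall c, 0 < c < T -> E (z c) /\ diff_quotient z c @ c^' --> F (z c) c) ->
    forall c, 0 < c < T -> diff_quotient z c @ c^' --> H (z c, c).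
  move=> z0 cz hz c /andP[c0 cT].
  have Sz : S (z c).
    apply: (@safe_set_invariant R n m f g y r alpha nu ymin ymax E kd fs ys vrd
      gns alpha1 ylt z (fun=> 1) c) => //; [exact: ltW| | |by rewrite z0].
      apply: continuous_subspaceW cz.
      by move=> s /=; rewrite !in_itv/= => /andP[-> /le_trans->] //; exact: ltW.
    move=> s /andP[s0 sc]; have [] := hz s; first by rewrite s0 (lt_trans sc).
    by move=> Es hs; split => //; rewrite scale1r.
  rewrite HF ?cS1// ?scale1r; last by rewrite !ltW.
  by have [] := hz c; rewrite ?c0.
apply: (@picard_unique R n H L M) => //; first by rewrite p0 q0.
  exact: key.
exact: key.
Qed.

Lemma closed_loop_global : exists x : R -> 'cV[R]_n,
  solution_on `[0, +oo[ E F x0 x /\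
  forall T z, 0 < T -> solution_on `[0, T[ E F x0 z ->
    forall t, 0 <= t < T -> z t = x t.
Proof.
have /choice[X hX] : forall T : R, exists x : R -> 'cV[R]_n, 0 <= T ->
    x 0 = x0 /\ forall t, 0 <= t <= T ->
      S (x t) /\ diff_quotient x t @ t^' --> F (x t) t.
  move=> T; have [T0|nT] := pselect (0 <= T); last by exists (fun=> x0) => /nT.
  by have [x hx] := closed_loop_exists T0; exists x.
have Xc T t : 0 <= T -> t <= T -> {within `[0, t], continuous (X T)}.
  move=> T0 tT; apply/subspace_continuousP => s /=; rewrite in_itv/= => /andP[s0 st].
  apply: (dq_continuous (l := F (X T s) s)); apply: cvg_within_filter.
  by apply: ((hX T T0).2 s _).2; rewrite s0 (le_trans st).
have Xd T t : 0 <= T -> t <= T ->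
    forall c, 0 < c < t -> E (X T c) /\ diff_quotient (X T) c @ c^' --> F (X T c) c.
  move=> T0 tT c /andP[c0 ct]; have [|] := (hX T T0).2 c.
    by rewrite ltW// (le_trans (ltW ct)).
  by move=> /SE.
(* The absolute value keeps the horizon nonnegative for every real [t]; by [xX] any horizon not
   below [t] gives the same value at a nonnegative time. *)
pose x t := X (`|t| + 1) t.
have x1 (t : R) : t <= `|t| + 1 by rewrite (le_trans (ler_norm t))// lerDl.
have x1' (t : R) : 0 <= `|t| + 1 by rewrite addr_ge0.
have xX T t : 0 <= T -> 0 <= t <= T -> x t = X T t.
  move=> T0 /andP[t0 tT].
  apply: (@closed_loop_unique t (X (`|t| + 1)) (X T)) => //.
  - exact: (hX _ (x1' t)).1.
  - exact: (hX _ T0).1.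
  - exact: Xc.
  - exact: Xc.
  - exact: Xd.
  - exact: Xd.
have x00 : x 0 = x0 by exact: (hX _ (x1' 0)).1.
exists x; split.
  split => // t /=; rewrite in_itv/= andbT => t0.
  have t2 : 0 <= t + 1 by rewrite addr_ge0.
  have t1 : 0 <= t <= t + 1 by rewrite t0/= lerDl.
  have [St dX] := (hX _ t2).2 t t1.
  rewrite (xX _ _ t2 t1); split; first exact: SE.
  (* At nonnegative times within 1 of [t] the glued curve agrees with the single solution of horizon
     [t + 1], so the difference quotients coincide there; hence the restriction to nonnegative
     times. *)
  apply: (@cvg_trans _ (diff_quotient (X (t + 1)) t @ within `[0, +oo[ t^'));
    last exact: cvg_within_filter dX.
  apply: near_eq_cvg; near=> s.
  have s0 : `[0, +oo[%classic s by near: s; exact: withinT.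
  have s1 : `|t - s| < 1.
    by near: s; apply: cvg_within; apply: nbhs_dnbhs; exists 1 => //=.
  rewrite /= in_itv/= andbT in s0.
  rewrite /diff_quotient (xX _ _ t2 t1) (xX _ s t2)// s0/=.
  have := ler_norm (s - t); rewrite distrC; lra.
move=> T z T0 [z0 hz] t /andP[t0 tT].
have sub : `[0, t] `<=` `[0, T[.
  by move=> s /=; rewrite !in_itv/= => /andP[-> /le_lt_trans->].
apply: (@closed_loop_unique t z (X (`|t| + 1))) => //; first exact: (hX _ (x1' t)).1.
- apply: continuous_subspaceW sub _; apply/subspace_continuousP => s sT.
  exact: dq_continuous (hz s sT).2.
- exact: Xc.
- move=> c /andP[c0 ct].
  have cT : `[0, T[%classic c by rewrite /= in_itv/= ltW//= (lt_trans ct).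
  split; first exact: (hz c cT).1.
  apply: dq_interior (hz c cT).2; apply: (@filterS _ _ _ `]0, T[%classic).
    by move=> s /=; rewrite !in_itv/= => /andP[/ltW-> ->].
  by apply: near_in_itvoo; rewrite in_itv/= c0 (lt_trans ct).
- exact: Xd.
Unshelve. all: by end_near. Qed.

End ClosedLoop.

(** * Input-to-state estimate *)

Section InputToState.
Context {R : realType} {n m : nat}.
Variables (f : 'cV[R]_n -> 'cV[R]_n) (g : 'cV[R]_n -> 'M[R]_(n, m)).
Variables (kd kc : 'cV[R]_n -> R -> 'cV[R]_m) (V : 'cV[R]_n -> R -> R).
Variables (gamma sigma mu : R) (E : set 'cV[R]_n) (x0 : 'cV[R]_n).
Variable x : R -> 'cV[R]_n.
Hypothesis VC1 : C1_nonneg_time V.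
Hypothesis g0 : 0 < gamma.
Hypothesis s0 : 0 < sigma.
Hypothesis Vdecay : forall x t, 0 <= t ->
  derive_within `[0, +oo[ (V x) t
    + (grad (V^~ t) x *m (f x + g x *m kd x t)) 0 0
  <= - gamma * V x t - sigma * enorm (grad (V^~ t) x *m g x) ^+ 2.
Hypothesis xsol :
  solution_on `[0, +oo[ E (fun x t => f x + g x *m (kd x t + kc x t)) x0 x.
Hypothesis kc_mu : forall t, 0 <= t -> enorm (kc (x t) t) <= mu.

Lemma iss_estimate t : 0 <= t ->
  V (x t) t <= expR (- gamma * t) * V (x 0) 0 + mu ^+ 2 / (4 * sigma) / gamma.
Proof.
move=> t0; have [_ hx] := xsol.
have dx s : 0 <= s -> diff_quotient x s @ within `[0, +oo[ s^' -->
    f (x s) + g (x s) *m (kd (x s) s + kc (x s) s).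
  by move=> s_ge0; apply: (hx s _).2; rewrite /= in_itv/= s_ge0.
have K0 : 0 <= mu ^+ 2 / (4 * sigma) by rewrite divr_ge0 ?sqr_ge0// mulr_ge0// ltW.
apply: (@gronwall_decay R (fun s => V (x s) s) _ gamma _ t t0 g0 K0).
- apply/subspace_continuousP => s /=; rewrite in_itv/= => /andP[s_ge0 _].
  (* The chain rule covers positive times only; continuity of [V] along [x], time 0 included, comes
     from the local Lipschitz bound. *)
  have [L [d [L0 d0 hL]]] := C1_lip_near VC1 (x s) s_ge0.
  have xc := dq_continuous (dx s s_ge0).
  apply/cvgrPdist_le => e e0; have eL : 0 < Num.min d (e / L).
    by rewrite lt_min d0 divr_gt0.
  move/cvgrPdist_lt : xc => /(_ _ eL)[d' /= d'0 hd'].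
  exists (Num.min d' (Num.min d (e / L))) => /=; first by rewrite lt_min d'0.
  move=> z /=; rewrite lt_min => /andP[zd' zd]; rewrite in_itv/= => /andP[z0 _].
  have xzd : `|x s - x z| < Num.min d (e / L).
    by apply: hd' => //=; rewrite in_itv/= z0.
  have pn : `|(x s, s) - (x z, z)| < Num.min d (e / L).
    by rewrite prod_normE/= gt_max xzd.
  have := hL (x s, s) s_ge0; rewrite subrr normr0 => /(_ d0)[_ /(_ (x z, z) z0)].
  move: pn; rewrite lt_min => /andP[pd pe]; rewrite distrC pd => /(_ isT) h.
  apply: le_trans h _; rewrite mulrC -ler_pdivlMr//; exact: ltW.
- move=> s /andP[s_gt0 _]; apply: (C1_chain VC1 s_gt0).
  apply: dq_interior (dx s (ltW s_gt0)).
  apply: (@filterS _ _ _ `]0, +oo[%classic).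
    by move=> z /=; rewrite !in_itv/= !andbT; exact: ltW.
  by apply: near_in_itvoy; rewrite in_itv/= s_gt0.
move=> s /andP[s_gt0 _] /=; have s_ge0 := ltW s_gt0.
have hk : enorm (kc (x s) s) ^+ 2 / (4 * sigma) <= mu ^+ 2 / (4 * sigma).
  by rewrite ler_pM2r ?invr_gt0 ?mulr_gt0// lerXn2r ?nnegrE ?enorm_ge0//
    ?kc_mu// (le_trans (enorm_ge0 _) (kc_mu s_ge0)).
have := Vdecay (x s) s_ge0.
have := mulmx_young (grad (V^~ s) (x s) *m g (x s)) (kc (x s) s) s0.
have split_kc (w : 'rV[R]_n) : (w *m (f (x s) + g (x s) *m (kd (x s) s + kc (x s) s))) 0 0 =
    (w *m (f (x s) + g (x s) *m kd (x s) s)) 0 0 + (w *m g (x s) *m kc (x s) s) 0 0.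
  by rewrite (mulmxDr (g (x s))) addrA (mulmxDr w) mulmxA [LHS]mxE.
rewrite split_kc; lra.
Qed.

End InputToState.

Theorem proposition1 (R : realType) (n m : nat)
    (f : 'cV[R]_n -> 'cV[R]_n) (g : 'cV[R]_n -> 'M[R]_(n, m))
    (y : 'cV[R]_n -> 'cV[R]_m) (r : 'I_m -> nat)
    (alpha nu : 'I_m -> nat -> R) (ymin ymax : 'I_m -> R)
    (E : set 'cV[R]_n)
    (yd : R -> 'cV[R]_m) (kd : 'cV[R]_n -> R -> 'cV[R]_m)
    (V : 'cV[R]_n -> R -> R) (rho gamma sigma : R) (x0 : 'cV[R]_n) :
  let S := safe_set f y r nu ymin ymax in
  let e x t := y x - yd t in
  let k_cbf := kcbf f g y r alpha ymin ymax kd in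
  let F := closed_loop f g y r alpha ymin ymax kd in
  smooth f -> smooth g -> smooth y ->
  open E -> S `<=` E -> vector_relative_degree_on f g y r E ->
  gains r alpha nu -> (forall i, 0 < alpha i 1%N) ->
  (forall i, ymin i < ymax i) ->
  smooth_within `[0, +oo[ yd ->
  [locally [lipschitz kd p.1 p.2 | p in [set p : 'cV[R]_n * R | 0 <= p.2]]] ->
  C1_nonneg_time V -> (forall x t, 0 <= t -> 0 <= V x t) ->
  0 < rho -> 0 < gamma -> 0 < sigma ->
  (forall x t, 0 <= t -> rho * enorm (e x t) ^+ 2 <= V x t) ->
  (forall x t, 0 <= t ->
     derive_within `[0, +oo[ (V x) t
       + (grad (V^~ t) x *m (f x + g x *m kd x t)) 0 0
     <= - gamma * V x t - sigma * enorm (grad (V^~ t) x *m g x) ^+ 2) ->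
  compact S -> S x0 ->
  (forall k, exists M, forall t, 0 <= t ->
     enorm (iter k (derive_within `[0, +oo[) yd t) <= M) ->
  exists x : R -> 'cV[R]_n,
    [/\ solution_on `[0, +oo[ E F x0 x,
        forall T z, 0 < T -> solution_on `[0, T[ E F x0 z ->
          forall t, 0 <= t < T -> z t = x t &
        forall t, 0 <= t ->
          ((enorm (e (x t) t))%:E <=
             (beta_bound rho gamma (V (x 0) 0) t)%:E
             + iota_gain rho gamma sigma
                 (sup_norm_nonneg (fun s => k_cbf (x s) s)))%E].
Proof.
move=> S e k_cbf F fs gs ys oE SE vrd gns a1 ylt _ kdlip VC1 V0 rho0 g0 s0
  Vlow Vdecay cS Sx0 _.
have [x [xsol xuniq]] := @closed_loop_global R n m f g y r alpha nu ymin ymax E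
  kd fs gs ys vrd kdlip gns a1 ylt oE SE cS x0 Sx0.
exists x; split => // t t0.
have rgs : 0 < gamma * rho * sigma by rewrite !mulr_gt0.
pose q := Num.sqrt (gamma * rho * sigma).
have q0 : 0 < q by rewrite sqrtr_gt0.
have qE : q ^+ 2 = gamma * rho * sigma by rewrite sqr_sqrtr// ltW.
have ub s : 0 <= s ->
    ((enorm (k_cbf (x s) s))%:E <= sup_norm_nonneg (fun s => k_cbf (x s) s))%E.
  by move=> s_ge0; apply: ereal_sup_ubound; exists s => //=; rewrite in_itv/= s_ge0.
(* The norm at time 0 belongs to the set, so the supremum is not -oo; if it is +oo, the positive
   factor in [iota_gain] makes the bound trivial. *)
rewrite /iota_gain -/q; case: (sup_norm_nonneg _) ub => [mu| |] ub; last first.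
- by have := ub 0 (lexx 0); rewrite leeNy_eq.
- by rewrite gt0_mulye ?lte_fin ?invr_gt0 ?mulr_gt0// addey// leey.
have kmu s : 0 <= s -> enorm (k_cbf (x s) s) <= mu by move=> /ub; rewrite lee_fin.
have mu0 : 0 <= mu := le_trans (enorm_ge0 _) (kmu 0 (lexx 0)).
rewrite -EFinM -EFinD lee_fin /beta_bound.
have hV := iss_estimate VC1 g0 s0 Vdecay xsol kmu t0.
set A := Num.sqrt _ * _; set B := mu * _.
have A0 : 0 <= A by rewrite mulr_ge0 ?sqrtr_ge0 ?expR_ge0.
have B0 : 0 <= B by rewrite mulr_ge0// invr_ge0 mulr_ge0// ltW.
have A2 : A ^+ 2 = expR (- gamma * t) * V (x 0) 0 / rho.
  rewrite exprMn sqr_sqrtr ?divr_ge0 ?V0// ?(ltW rho0)//.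
  rewrite -expRM_natl mulrC -mulrA; congr (expR _ * _); first by field.
(* The divisors stem from the completed square, Gronwall's constant term and the lower bound on [V];
   the root of their product is the denominator of [iota_gain]. *)
have B2 : B ^+ 2 = mu ^+ 2 / (4 * sigma) / gamma / rho.
  by rewrite exprMn exprVn exprMn qE; field; rewrite !gt_eqF.
(* Subadditivity of the square root in squared form: A^2 + B^2 <= (A + B)^2 for nonnegative [A] and
   [B]. *)
rewrite -(@ler_pXn2r _ 2) ?nnegrE ?enorm_ge0 ?addr_ge0//.
apply: (@le_trans _ _ (A ^+ 2 + B ^+ 2)); last first.
  have := mulr_ge0 A0 B0; rewrite sqrrD; lra.
rewrite A2 B2 -mulrDl ler_pdivlMr// mulrC; apply: le_trans hV; exact: Vlow.
Qed.
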